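(* For every integer $\omega$ and every $\mathsf{MSO}_1$-sentence $\psi$ on graphs, there is a proof labeling scheme $(\mathsf{P},\mathsf{V})$ of size $O(\log n)$ for the class of connected graphs that have locally verifiable treewidth at most $\omega$ and satisfy $\psi$.
   Context: An $\mathsf{MSO}_1$-sentence on graphs is a monadic second-order sentence (quantifiers over vertices and over sets of vertices) over the vocabulary consisting of one binary predicate $\mathsf{edge}$, interpreted on the structure with universe $V(G)$ and $\mathsf{edge}(u,v)$ iff $uv\in E(G)$. An elimination tree of a connected graph $G$ is a rooted tree $F$ with $V(F)=V(G)$ such that for every edge $uv$ of $G$ one endpoint is an ancestor of the other in $F$; with $F_v$ the subtree rooted at $v$ and $\mathsf{str}(v)$ the set of $v$ and all strict ancestors of $v$ with a neighbour in $V(F_v)$, the width of $F$ is $\max_v|\mathsf{str}(v)|-1$. An oriented path system over $G$ is a set of oriented paths each obtained by orienting a path of $G$; the congestion of a vertex $v$ is the number of its paths having $v$ as starting or internal vertex, and the congestion of the system is the maximum over vertices; it witnesses $F$ if for every non-root $v$ with parent $\mathsf{p}(v)$, either $v\mathsf{p}(v)\in E(G)$ or the system contains a path oriented from $v$ to $\mathsf{p}(v)$. A graph has locally verifiable treewidth at most $k$ if each component has an elimination tree of width at most $k$ and a witnessing oriented path system of congestion at most $k$. Proof labeling scheme: vertices have unique identifiers in $\{1,\dots,n\}$; the prover assigns binary labels; the verifier at $v$ sees only $\mathsf{id}(v)$ and $(\mathsf{id}(w),\varphi(w))$ for $w\in N[v]$ and outputs Yes/No; completeness: on graphs in the class the prover's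 labels make all vertices accept; soundness: on graphs outside it, every labeling makes some vertex reject; size $O(\log n)$: labels have length $O(\log n)$. *)

(* Defs.v *)
From mathcomp Require Import all_boot all_order ssralg ssrnum ssrint.
Set Implicit Arguments. Unset Strict Implicit. Unset Printing Implicit Defensive.
Import Order.TTheory GRing.Theory Num.Theory.

(* ---------- Finite simple graphs on the vertex set 'I_n.+1 ----------
   Vertex i carries the identifier i.+1, so identifiers are exactly {1,...,n+1}. *)
Record graph (n : nat) := Graph {
  adj : rel 'I_n.+1;
  adj_sym : symmetric adj;
  adj_irr : irreflexive adj }.

Definition connectedG n (G : graph n) : Prop := forall x y, connect (adj G) x y.

Definition component n (G : graph n) (x : 'I_n.+1) : {set 'I_n.+1} :=
  [set y | connect (adj G) x y].

Definition anc (T : finType) (par : T -> T) (u v : T) : bool := fconnect par v u.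

(* par / r describe a rooted tree F with V(F) = C, root r, parent p(v) = par v,
   and every edge of G inside C joins an ancestor/descendant pair. *)
Definition is_elim_tree n (G : graph n) (C : {set 'I_n.+1})
    (par : 'I_n.+1 -> 'I_n.+1) (r : 'I_n.+1) : Prop :=
  [/\ r \in C, par r = r,
      (forall v, v \in C -> par v \in C),
      (forall v, v \in C -> anc par r v) &
      (forall u v, u \in C -> v \in C -> adj G u v -> anc par u v || anc par v u)].

Definition subtree n (C : {set 'I_n.+1}) (par : 'I_n.+1 -> 'I_n.+1) (v : 'I_n.+1)
  : {set 'I_n.+1} := [set w in C | anc par v w].

Definition str n (G : graph n) (C : {set 'I_n.+1}) (par : 'I_n.+1 -> 'I_n.+1)
    (v : 'I_n.+1) : {set 'I_n.+1} :=
  [set u | (u == v) ||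
           [&& u != v, anc par u v & [exists w in subtree C par v, adj G u w]]].

Definition width_le n (G : graph n) (C : {set 'I_n.+1}) (par : 'I_n.+1 -> 'I_n.+1)
    (k : int) : Prop :=
  forall v, v \in C -> ((#|str G C par v|)%:Z - 1 <= k)%R.

Definition is_opath n (G : graph n) (P : seq 'I_n.+1) : bool :=
  if P is x :: s then path (adj G) x s && uniq P else false.

Definition opath_system n (G : graph n) (ps : seq (seq 'I_n.+1)) : bool :=
  all (is_opath G) ps && uniq ps.

Definition congestion_at n (ps : seq (seq 'I_n.+1)) (v : 'I_n.+1) : nat :=
  count (fun P => (v \in P) && ((v == head v P) || (v != last v P))) ps.

Definition witnesses n (G : graph n) (C : {set 'I_n.+1}) (par : 'I_n.+1 -> 'I_n.+1)
    (r : 'I_n.+1) (ps : seq (seq 'I_n.+1)) : Prop :=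
  forall v, v \in C -> v != r ->
    adj G v (par v) \/ exists s, rcons (v :: s) (par v) \in ps.

Definition lvtw_le n (G : graph n) (k : int) : Prop :=
  forall x, exists (par : 'I_n.+1 -> 'I_n.+1) (r : 'I_n.+1) (ps : seq (seq 'I_n.+1)),
    [/\ is_elim_tree G (component G x) par r,
        width_le G (component G x) par k,
        opath_system G ps,
        (forall v, ((congestion_at ps v)%:Z <= k)%R) &
        witnesses G (component G x) par r ps].

(* first-order variables and set variables are indexed by nat (separate sorts) *)
Inductive mso : Type :=
  | MEdge of nat & nat
  | MEq of nat & nat
  | MIn of nat & nat
  | MNot of mso
  | MAnd of mso & mso
  | MOr of mso & mso
  | MEx1 of nat & mso
  | MAll1 of nat & mso
  | MEx2 of nat & mso
  | MAll2 of nat & mso.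

Fixpoint mso_closed (b1 b2 : seq nat) (f : mso) : bool :=
  match f with
  | MEdge x y | MEq x y => (x \in b1) && (y \in b1)
  | MIn x X => (x \in b1) && (X \in b2)
  | MNot g => mso_closed b1 b2 g
  | MAnd g h | MOr g h => mso_closed b1 b2 g && mso_closed b1 b2 h
  | MEx1 x g | MAll1 x g => mso_closed (x :: b1) b2 g
  | MEx2 X g | MAll2 X g => mso_closed b1 (X :: b2) g
  end.

Definition mso_sentence (f : mso) : bool := mso_closed [::] [::] f.

Fixpoint mso_holds n (G : graph n) (e1 : nat -> 'I_n.+1) (e2 : nat -> {set 'I_n.+1})
    (f : mso) : Prop :=
  match f with
  | MEdge x y => adj G (e1 x) (e1 y)
  | MEq x y => e1 x = e1 y
  | MIn x X => e1 x \in e2 X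
  | MNot g => ~ mso_holds G e1 e2 g
  | MAnd g h => mso_holds G e1 e2 g /\ mso_holds G e1 e2 h
  | MOr g h => mso_holds G e1 e2 g \/ mso_holds G e1 e2 h
  | MEx1 x g => exists v, mso_holds G (fun i => if i == x then v else e1 i) e2 g
  | MAll1 x g => forall v, mso_holds G (fun i => if i == x then v else e1 i) e2 g
  | MEx2 X g => exists S, mso_holds G e1 (fun i => if i == X then S else e2 i) g
  | MAll2 X g => forall S, mso_holds G e1 (fun i => if i == X then S else e2 i) g
  end.

(* G |= psi (for a sentence the assignment is irrelevant) *)
Definition models n (G : graph n) (psi : mso) : Prop :=
  mso_holds G (fun _ => ord0) (fun _ => set0) psi.

Definition view n (G : graph n) (lab : 'I_n.+1 -> bitseq) (v : 'I_n.+1)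
  : seq (nat * bitseq) :=
  [seq ((val w).+1, lab w) | w <- enum 'I_n.+1 & (w == v) || adj G v w].

Definition has_log_PLS (cls : forall n, graph n -> Prop) : Prop :=
  exists (Pr : forall n, graph n -> 'I_n.+1 -> bitseq)
         (Vf : nat -> seq (nat * bitseq) -> bool),
    [/\
        (forall n (G : graph n), cls n G -> forall v, Vf (val v).+1 (view G (Pr n G) v)),
        (forall n (G : graph n), ~ cls n G ->
           forall lab, exists v, ~~ Vf (val v).+1 (view G lab v)) &
        exists c, forall n (G : graph n), cls n G ->
           forall v, size (Pr n G v) <= c * (trunc_log 2 n.+1).+1].

(* Main.v *)
Require Import Defs.
From HB Require Import structures.
From mathcomp Require Import all_boot all_order ssralg ssrnum ssrint.
From mathcomp Require Import boolp zify.
Set Implicit Arguments. Unset Strict Implicit. Unset Printing Implicit Defensive.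

(** The certificate of a vertex consists of its parent and depth in an
    elimination tree, the vertices of [str v] indexed by a coloring with
    [omega + 1] colors that is injective on every [str v], and the state that a
    tree automaton reaches on the forest below it.  An edge of the graph joins a
    vertex to the closest ancestor of some color, so the graph is encoded by a
    tree over a finite alphabet, and MSO becomes recognizable by automata on the
    first-child/next-sibling encoding (closure under Boolean operations and
    projection).  A vertex that is not adjacent to its parent has a copy of its
    information carried along its path of the oriented path system; the bounded
    congestion keeps labels short, and counters along the path ensure that each
    parent sees the genuine information of each of its children.  Connectivity is
    certified by the distance to the vertex with the smallest identifier. *)

(** * Automata on binary trees *)

Inductive btree (A : Type) := Leaf | Node of A & btree A & btree A.
Arguments Leaf {A}.

Fixpoint btree_map A B (f : A -> B) t :=
  if t is Node a t1 t2 then Node (f a) (btree_map f t1) (btree_map f t2) else Leaf.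

Fixpoint nodes A (t : btree A) : seq A :=
  if t is Node a t1 t2 then a :: nodes t1 ++ nodes t2 else [::].

Lemma nodes_map A B (f : A -> B) t : nodes (btree_map f t) = map f (nodes t).
Proof. by elim: t => //= a t1 -> t2 ->; rewrite map_cat. Qed.

Lemma btree_map_comp A B C (f : B -> C) (g : A -> B) t :
  btree_map f (btree_map g t) = btree_map (f \o g) t.
Proof. by elim: t => //= a t1 -> t2 ->. Qed.

Lemma eq_in_btree_map (V : eqType) A (f g : V -> A) t :
  {in nodes t, f =1 g} -> btree_map f t = btree_map g t.
Proof.
elim: t => //= v t1 IH1 t2 IH2 fg; rewrite fg ?mem_head // IH1 ?IH2 // => w wt.
all: by apply: fg; rewrite inE mem_cat wt ?orbT.
Qed.

Lemma btree_map_fst_lift (V : eqType) A B (b0 : B) (g : V -> A) t (t' : btree (A * B)) :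
  uniq (nodes t) -> btree_map fst t' = btree_map g t ->
  exists h : V -> B, t' = btree_map (fun v => (g v, h v)) t.
Proof.
elim: t t' => [|v t1 IH1 t2 IH2] [|[a b] t1' t2'] //; first by exists (fun=> b0).
rewrite /= cat_uniq mem_cat negb_or -andbA.
case/and5P=> vt1 vt2 ut1 /hasPn t1t2 ut2 [-> /(IH1 _ ut1)[h1 ->] /(IH2 _ ut2)[h2 ->]].
exists (fun w => if w == v then b else if w \in nodes t1 then h1 w else h2 w).
rewrite eqxx; congr Node; apply: eq_in_btree_map => w wt.
  by rewrite wt (negbTE (memPn vt1 w wt)).
by rewrite (negbTE (t1t2 w wt)) (negbTE (memPn vt2 w wt)).
Qed.

(* The first-child/next-sibling encoding of the forest with roots [s], where [f c]
   encodes the forest below [c]. *)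
Definition graft A (f : A -> btree A) s := foldr (fun c => Node c (f c)) Leaf s.

Lemma eq_in_graft (V : eqType) (f g : V -> btree V) s :
  {in s, f =1 g} -> graft f s = graft g s.
Proof.
elim: s => //= c s IH fg; rewrite fg ?mem_head // IH // => c' c's.
by rewrite fg // inE c's orbT.
Qed.

Lemma mem_nodes_graft (V : eqType) (f : V -> btree V) s w :
  (w \in nodes (graft f s)) = has (fun c => (w == c) || (w \in nodes (f c))) s.
Proof. by elim: s => //= c s IH; rewrite inE mem_cat IH orbA. Qed.

Record automaton (A : Type) := Automaton {
  state : finType;
  init : state;
  step : A -> state -> state -> state;
  final : pred state }.

Fixpoint run A (M : automaton A) t : state M :=
  if t is Node a t1 t2 then step a (run M t1) (run M t2) else init M.

Definition accepted A (M : automaton A) t := final (run M t).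

Definition run_forest T A (M : automaton A) (f : T -> A) (st : T -> state M) s :=
  foldr (fun c => step (f c) (st c)) (init M) s.

Lemma eq_in_run_forest (T : eqType) A (M : automaton A) (f : T -> A) (st st' : T -> state M) s :
  {in s, st =1 st'} -> run_forest f st s = run_forest f st' s.
Proof.
elim: s => //= c s IH eq_st; rewrite eq_st ?mem_head // IH // => c' c's.
by rewrite eq_st // inE c's orbT.
Qed.

Lemma run_graft T A (M : automaton A) (f : T -> A) (g : T -> btree T) s :
  run M (btree_map f (graft g s)) = run_forest f (fun c => run M (btree_map f (g c))) s.
Proof. by elim: s => //= c s ->. Qed.

Definition recognizable A (L : btree A -> Prop) :=
  exists M : automaton A, forall t, L t <-> accepted M t.

Lemma recognizable_iff A (L L' : btree A -> Prop) :
  (forall t, L t <-> L' t) -> recognizable L -> recognizable L'.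
Proof. by move=> LL' [M MP]; exists M => t; rewrite -LL'. Qed.

Definition complement_automaton A (M : automaton A) :=
  Automaton (init M) (@step _ M) (predC (@final _ M)).

Lemma accepted_complement A (M : automaton A) t :
  accepted (complement_automaton M) t = ~~ accepted M t.
Proof.
rewrite /accepted; suff -> : run (complement_automaton M) t = run M t by [].
by elim: t => //= a t1 -> t2 ->.
Qed.

Lemma recognizable_not A (L : btree A -> Prop) :
  recognizable L -> recognizable (fun t => ~ L t).
Proof.
case=> M MP; exists (complement_automaton M) => t.
by rewrite accepted_complement MP; split=> /negP.
Qed.

Definition product_automaton A (op : bool -> bool -> bool) (M N : automaton A) :=
  @Automaton A (state M * state N)%type (init M, init N)
    (fun a p q => (step a p.1 q.1, step a p.2 q.2)) (fun p => op (final p.1) (final p.2)).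

Lemma accepted_product A op (M N : automaton A) t :
  accepted (product_automaton op M N) t = op (accepted M t) (accepted N t).
Proof.
rewrite /accepted; suff -> : run (product_automaton op M N) t = (run M t, run N t) by [].
by elim: t => //= a t1 -> t2 ->.
Qed.

Lemma recognizable_and A (L L' : btree A -> Prop) :
  recognizable L -> recognizable L' -> recognizable (fun t => L t /\ L' t).
Proof.
move=> [M MP] [N NP]; exists (product_automaton andb M N) => t.
by rewrite accepted_product MP NP; split=> /andP.
Qed.

Lemma recognizable_or A (L L' : btree A -> Prop) :
  recognizable L -> recognizable L' -> recognizable (fun t => L t \/ L' t).
Proof.
move=> [M MP] [N NP]; exists (product_automaton orb M N) => t.
by rewrite accepted_product MP NP; split=> /orP.
Qed.

Definition preim_automaton A B (g : A -> B) (M : automaton B) :=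
  Automaton (init M) (fun a => step (g a)) (@final _ M).

Lemma run_preim A B (g : A -> B) (M : automaton B) t :
  run (preim_automaton g M) t = run M (btree_map g t).
Proof. by elim: t => //= a t1 -> t2 ->. Qed.

Lemma recognizable_preim A B (g : A -> B) (L : btree B -> Prop) :
  recognizable L -> recognizable (fun t => L (btree_map g t)).
Proof.
by case=> M MP; exists (preim_automaton g M) => t; rewrite MP /accepted run_preim.
Qed.

Definition subset_automaton A (B : finType) (M : automaton (A * B)) :=
  @Automaton A {set state M} [set init M]
    (fun a P P' => [set q | [exists b : B, exists p in P, exists p' in P', q == step (a, b) p p']])
    (fun P => [exists p in P, final p]).

Lemma mem_run_subset A (B : finType) (M : automaton (A * B)) t q :
  q \in run (subset_automaton M) t <-> exists2 t', btree_map fst t' = t & q = run M t'.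
Proof.
elim: t q => [|a t1 IH1 t2 IH2] q /=.
  by rewrite inE; split=> [/eqP->|[[|??] //= _ ->] //]; exists Leaf.
rewrite inE; split.
  case/existsP=> b /exists_inP[p /IH1[t1' <- ->]] /exists_inP[p' /IH2[t2' <- ->]] /eqP->.
  by exists (Node (a, b) t1' t2').
case=> [[|[a' b] t1' t2']] //= [-> e1 e2] ->.
apply/existsP; exists b; apply/exists_inP; exists (run M t1'); first by apply/IH1; exists t1'.
by apply/exists_inP; exists (run M t2') => //; apply/IH2; exists t2'.
Qed.

Lemma recognizable_proj A (B : finType) (L : btree (A * B) -> Prop) :
  recognizable L -> recognizable (fun t => exists2 t', btree_map fst t' = t & L t').
Proof.
case=> M MP; exists (subset_automaton M) => t; split.
  case=> t' et /MP Mt'; apply/exists_inP; exists (run M t') => //.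
  by apply/mem_run_subset; exists t'.
by case/exists_inP=> q /mem_run_subset[t' et ->] Mt'; exists t' => //; apply/MP.
Qed.

Lemma recognizable_annotation A (B : finType) (b0 : B) (L : btree (A * B) -> Prop) :
  recognizable L -> exists2 L' : btree A -> Prop, recognizable L' &
  forall (V : eqType) (g : V -> A) t, uniq (nodes t) ->
    L' (btree_map g t) <-> exists h : V -> B, L (btree_map (fun v => (g v, h v)) t).
Proof.
move=> rL; exists (fun t => exists2 t', btree_map fst t' = t & L t').
  exact: recognizable_proj.
move=> V g t ut; split=> [[t' /(btree_map_fst_lift b0 ut)[h ->] Lt]|[h Lt]]; first by exists h.
by exists (btree_map (fun v => (g v, h v)) t) => //; rewrite btree_map_comp.
Qed.

(* It suffices to count up to [m + 1]. *)
Lemma recognizable_count A (p : pred A) m :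
  recognizable (fun t => count p (nodes t) = m).
Proof.
pose M := @Automaton A 'I_m.+2 ord0 (fun a i j => inord (minn m.+1 (p a + i + j)))
  (fun i => val i == m).
exists M => t; have -> : accepted M t = (minn m.+1 (count p (nodes t)) == m).
  suff : val (run M t) = minn m.+1 (count p (nodes t)) by rewrite /accepted /= => ->.
  elim: t => //= a t1 IH1 t2 IH2; rewrite inordK ?count_cat; last by lia.
  by move: IH1 IH2 => /= -> ->; lia.
by split=> [->|/eqP]; lia.
Qed.

Lemma recognizable_has A (p : pred A) : recognizable (fun t => has p (nodes t)).
Proof.
apply: recognizable_iff (recognizable_not (recognizable_count p 0)) => t.
by rewrite has_count; split; lia.
Qed.

(** * Monadic second-order logic on colored trees *)

(* A node carries its color and the set of colors of its neighbors among its
   ancestors; a color refers to the closest strict ancestor of that color. *)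
Definition node_label K := ('I_K * {set 'I_K})%type.

(* [v] has a neighbor of color [a] above the root of [t]. *)
Fixpoint dangling (V : eqType) K (l : V -> node_label K) t (a : 'I_K) (v : V) : bool :=
  if t is Node u t1 t2 then
    [|| (v == u) && (a \in (l u).2),
        (a != (l u).1) && dangling l t1 a v | dangling l t2 a v]
  else false.

Fixpoint down_edge (V : eqType) K (l : V -> node_label K) t (u v : V) : bool :=
  if t is Node w t1 t2 then
    [|| (u == w) && dangling l t1 (l w).1 v, down_edge l t1 u v | down_edge l t2 u v]
  else false.

Lemma dangling_graft (V : eqType) K (l : V -> node_label K) f s a v :
  dangling l (graft f s) a v =
  has (fun c => (v == c) && (a \in (l c).2) || (a != (l c).1) && dangling l (f c) a v) s.
Proof. by elim: s => //= c s <-; rewrite orbA. Qed.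

Lemma down_edge_graft (V : eqType) K (l : V -> node_label K) f s u v :
  down_edge l (graft f s) u v =
  has (fun c => (u == c) && dangling l (f c) (l c).1 v || down_edge l (f c) u v) s.
Proof. by elim: s => //= c s <-; rewrite orbA. Qed.

Record encodes n K (t : btree 'I_n.+1) (l : 'I_n.+1 -> node_label K) (G : graph n) : Prop :=
  Encodes {
    encodes_uniq : uniq (nodes t);
    encodes_all v : v \in nodes t;
    encodes_adj u v : adj G u v = down_edge l t u v || down_edge l t v u }.

Record letter K := Letter {
  letter_label : node_label K;
  letter_point : nat -> bool;
  letter_set : nat -> bool }.

Definition valued_letter n K (l : 'I_n.+1 -> node_label K) e1 (e2 : nat -> {set 'I_n.+1}) v :=
  Letter (l v) (fun i => e1 i == v) (fun i => v \in e2 i).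

(* The state records whether the edge from [x] down to [y] has been met, and the
   colors of the neighbors that [y] has further up. *)
Definition edge_automaton K x y : automaton (letter K) :=
  @Automaton _ (bool * {set 'I_K})%type (false, set0)
    (fun a p q => let: (c, N) := letter_label a in
       ([|| p.1, q.1 | letter_point a x && (c \in p.2)],
        q.2 :|: p.2 :\ c :|: (if letter_point a y then N else set0)))
    fst.

Lemma run_edge_automaton n K (l : 'I_n.+1 -> node_label K) e1 e2 x y t :
  run (edge_automaton K x y) (btree_map (valued_letter l e1 e2) t) =
  (down_edge l t (e1 x) (e1 y), [set a | dangling l t a (e1 y)]).
Proof.
elim: t => [|v t1 IH1 t2 IH2] /=; first by congr pair; apply/setP=> a; rewrite !inE.
rewrite {}IH1 {}IH2; case: (l v) => c N /=; congr pair.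
  by rewrite inE; do !case: (down_edge _ _ _ _); rewrite ?orbT ?orbF.
apply/setP=> a; rewrite !inE; case: (e1 y == v); rewrite ?inE ?orbF; last exact: orbC.
by rewrite orbC [X in _ || X]orbC.
Qed.

Lemma recognizable_edge K x y : exists2 L : btree (letter K) -> Prop, recognizable L &
  forall n (l : 'I_n.+1 -> node_label K) e1 e2 t,
    L (btree_map (valued_letter l e1 e2) t) <-> down_edge l t (e1 x) (e1 y).
Proof.
exists (accepted (edge_automaton K x y)); first by exists (edge_automaton K x y).
by move=> n l e1 e2 t; rewrite /accepted run_edge_automaton.
Qed.

Definition mark_point K x (ab : letter K * bool) : letter K :=
  let: (a, b) := ab in
  Letter (letter_label a) (fun i => if i == x then b else letter_point a i) (letter_set a).

Definition mark_set K X (ab : letter K * bool) : letter K :=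
  let: (a, b) := ab in
  Letter (letter_label a) (letter_point a) (fun i => if i == X then b else letter_set a i).

Lemma mark_point_valued n K (l : 'I_n.+1 -> node_label K) e1 e2 x u :
  @mark_point K x \o (fun v => (valued_letter l e1 e2 v, u == v)) =
  valued_letter l (fun i => if i == x then u else e1 i) e2.
Proof. by apply/funext=> v; congr Letter; apply/funext=> i /=; case: ifP. Qed.

Lemma mark_set_valued n K (l : 'I_n.+1 -> node_label K) e1 e2 X (S : {set 'I_n.+1}) :
  @mark_set K X \o (fun v => (valued_letter l e1 e2 v, v \in S)) =
  valued_letter l e1 (fun i => if i == X then S else e2 i).
Proof. by apply/funext=> v; congr Letter; apply/funext=> i /=; case: ifP. Qed.

Definition mso_recognizable K (f : mso) :=
  exists2 L : btree (letter K) -> Prop, recognizable L &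
  forall n (G : graph n) t l, encodes t l G -> forall e1 e2,
    mso_holds G e1 e2 f <-> L (btree_map (valued_letter l e1 e2) t).

Section MSORecognizable.
Variable K : nat.
Implicit Types f g : mso.

Lemma mso_recognizable_iff f g :
  (forall n (G : graph n) e1 e2, mso_holds G e1 e2 f <-> mso_holds G e1 e2 g) ->
  mso_recognizable K f -> mso_recognizable K g.
Proof. by move=> fg [L rL LP]; exists L => // *; rewrite -fg; apply: LP. Qed.

Lemma mso_recognizable_edge x y : mso_recognizable K (MEdge x y).
Proof.
have [[L rL LP] [L' rL' L'P]] := (recognizable_edge K x y, recognizable_edge K y x).
exists (fun t => L t \/ L' t); first exact: recognizable_or.
move=> n G t l tG e1 e2; rewrite /= (encodes_adj tG).
by split=> [/orP[/LP|/L'P]|[/LP|/L'P] ->]; [left|right| |rewrite orbT].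
Qed.

Lemma mso_recognizable_eq x y : mso_recognizable K (MEq x y).
Proof.
exists (fun t => has (fun a : letter K => letter_point a x && letter_point a y) (nodes t)).
  exact: recognizable_has.
move=> n G t l tG e1 e2; rewrite /= nodes_map has_map.
split=> [exy|/hasP[v _ /andP[/eqP-> /eqP->]]//].
by apply/hasP; exists (e1 x); rewrite ?(encodes_all tG) //= exy eqxx.
Qed.

Lemma mso_recognizable_in x X : mso_recognizable K (MIn x X).
Proof.
exists (fun t => has (fun a : letter K => letter_point a x && letter_set a X) (nodes t)).
  exact: recognizable_has.
move=> n G t l tG e1 e2; rewrite /= nodes_map has_map.
split=> [exX|/hasP[v _ /andP[/eqP-> //]]].
by apply/hasP; exists (e1 x); rewrite ?(encodes_all tG) //= exX eqxx.
Qed.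

Lemma mso_recognizable_not f : mso_recognizable K f -> mso_recognizable K (MNot f).
Proof.
case=> L rL LP; exists (fun t => ~ L t); first exact: recognizable_not.
by move=> n G t l tG e1 e2; rewrite /= (LP _ _ _ _ tG).
Qed.

Lemma mso_recognizable_and f g :
  mso_recognizable K f -> mso_recognizable K g -> mso_recognizable K (MAnd f g).
Proof.
case=> L rL LP [L' rL' L'P]; exists (fun t => L t /\ L' t); first exact: recognizable_and.
by move=> n G t l tG e1 e2; rewrite /= (LP _ _ _ _ tG) (L'P _ _ _ _ tG).
Qed.

Lemma mso_recognizable_or f g :
  mso_recognizable K f -> mso_recognizable K g -> mso_recognizable K (MOr f g).
Proof.
case=> L rL LP [L' rL' L'P]; exists (fun t => L t \/ L' t); first exact: recognizable_or.
by move=> n G t l tG e1 e2; rewrite /= (LP _ _ _ _ tG) (L'P _ _ _ _ tG).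
Qed.

Lemma mso_recognizable_ex2 X f : mso_recognizable K f -> mso_recognizable K (MEx2 X f).
Proof.
case=> L /(recognizable_preim (@mark_set K X))/(recognizable_annotation false)[L' rL' L'P] LP.
exists L' => // n G t l tG e1 e2; rewrite (L'P _ _ _ (encodes_uniq tG)) /=.
split=> [[S /(LP _ _ _ _ tG)]|[h]].
  by rewrite -mark_set_valued -btree_map_comp; exists (fun v => v \in S).
have -> : h = fun v => v \in [set u | h u] by apply/funext=> v; rewrite inE.
rewrite btree_map_comp mark_set_valued => Lt.
by exists [set u | h u]; apply/(LP _ _ _ _ tG).
Qed.

Lemma mso_recognizable_ex1 x f : mso_recognizable K f -> mso_recognizable K (MEx1 x f).
Proof.
case=> L /(recognizable_preim (@mark_point K x)).
move=> /(recognizable_and (recognizable_count snd 1))/(recognizable_annotation false).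
case=> L' rL' L'P LP; exists L' => // n G t l tG e1 e2.
rewrite (L'P _ _ _ (encodes_uniq tG)) /=.
have count_nodes (h : pred 'I_n.+1) :
    count snd (nodes (btree_map (fun v => (valued_letter l e1 e2 v, h v)) t)) = #|h|.
  rewrite nodes_map count_map -size_filter -(card_uniqP _) ?filter_uniq ?(encodes_uniq tG) //.
  by apply: eq_card => v; rewrite mem_filter (encodes_all tG) andbT.
split=> [[u /(LP _ _ _ _ tG)]|[h [+]]].
  rewrite -mark_point_valued -btree_map_comp; exists (fun v => u == v); split=> //.
  by rewrite count_nodes -(card1 u); apply: eq_card => v; rewrite unfold_in /= eq_sym.
rewrite count_nodes => /mem_card1[u hu].
have -> : h = fun v => u == v by apply/funext=> v; rewrite eq_sym; apply: hu.
by rewrite btree_map_comp mark_point_valued => Lt; exists u; apply/(LP _ _ _ _ tG).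
Qed.

Lemma mso_recognizable_all1 x f : mso_recognizable K f -> mso_recognizable K (MAll1 x f).
Proof.
move=> f_rec; apply: (@mso_recognizable_iff (MNot (MEx1 x (MNot f)))) => [n G e1 e2|].
  by rewrite /= -forallNE; split=> nnf v; [exact: contrapT|apply; exact: nnf].
exact/mso_recognizable_not/mso_recognizable_ex1/mso_recognizable_not.
Qed.

Lemma mso_recognizable_all2 X f : mso_recognizable K f -> mso_recognizable K (MAll2 X f).
Proof.
move=> f_rec; apply: (@mso_recognizable_iff (MNot (MEx2 X (MNot f)))) => [n G e1 e2|].
  by rewrite /= -forallNE; split=> nnf S; [exact: contrapT|apply; exact: nnf].
exact/mso_recognizable_not/mso_recognizable_ex2/mso_recognizable_not.
Qed.

Theorem mso_recognizableT f : mso_recognizable K f.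
Proof.
elim: f => [x y|x y|x X|f IH|f IHf g IHg|f IHf g IHg|x f IH|x f IH|X f IH|X f IH].
- exact: mso_recognizable_edge.
- exact: mso_recognizable_eq.
- exact: mso_recognizable_in.
- exact: mso_recognizable_not.
- exact: mso_recognizable_and.
- exact: mso_recognizable_or.
- exact: mso_recognizable_ex1.
- exact: mso_recognizable_all1.
- exact: mso_recognizable_ex2.
- exact: mso_recognizable_all2.
Qed.

End MSORecognizable.

Definition decides K (M : automaton (letter K)) (f : mso) :=
  forall n (G : graph n) t l, encodes t l G -> forall e1 e2,
    mso_holds G e1 e2 f <-> accepted M (btree_map (valued_letter l e1 e2) t).

Corollary mso_automaton_exists K f : exists M : automaton (letter K), decides M f.
Proof.
have [L [M MP] LP] := mso_recognizableT K f.
by exists M => n G t l tG e1 e2; rewrite (LP _ _ _ _ tG).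
Qed.

(** * Rooted trees given by a parent map and a depth function *)

Record ranked (T : eqType) (par : T -> T) (d : T -> nat) (r : T) : Prop := Ranked {
  depth_eq0 v : (d v == 0) = (v == r);
  depth_parent v : d (par v) = (d v).-1 }.

Lemma depth_iter (T : Type) (par : T -> T) (d : T -> nat) :
  (forall v, d (par v) = (d v).-1) -> forall j v, d (iter j par v) = d v - j.
Proof. by move=> d_par j v; elim: j => [|j IH]; rewrite ?subn0 // iterS d_par IH subnS. Qed.

Record children (T : eqType) (par : T -> T) (d : T -> nat) (ch : T -> seq T) : Prop := Children {
  uniq_children p : uniq (ch p);
  mem_children p c : (c \in ch p) = (0 < d c) && (par c == p) }.

Definition children_of (T : finType) (par : T -> T) (d : T -> nat) p :=
  [seq c <- enum T | (0 < d c) && (par c == p)].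

Lemma children_ofP (T : finType) (par : T -> T) (d : T -> nat) :
  children par d (children_of par d).
Proof.
split=> [p|p c]; first by rewrite filter_uniq ?enum_uniq.
by rewrite mem_filter mem_enum andbT.
Qed.

Section RankedTree.
Variables (T : finType) (par : T -> T) (d : T -> nat) (r : T).
Hypothesis rk : ranked par d r.

Lemma depth_root : d r = 0.
Proof. by apply/eqP; rewrite (depth_eq0 rk). Qed.

Lemma parent_root : par r = r.
Proof. by apply/eqP; rewrite -(depth_eq0 rk) (depth_parent rk) depth_root. Qed.

Lemma parent_ind (P : T -> Prop) :
  P r -> (forall v, 0 < d v -> P (par v) -> P v) -> forall v, P v.
Proof.
move=> Pr Ppar v; move: {2}(d v) (erefl (d v)) => m; elim: m v => [|m IH] v dv.
  by move/eqP: dv; rewrite (depth_eq0 rk) => /eqP->.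
by apply: Ppar; [rewrite dv|apply: IH; rewrite (depth_parent rk) dv].
Qed.

Lemma depth_lt_card v : d v < #|T|.
Proof.
rewrite -[X in X <= _](card_ord (d v).+1).
apply: (leq_card (fun j : 'I_(d v).+1 => iter j par v)) => i j /(congr1 d).
rewrite !(depth_iter (depth_parent rk)) => eij; apply/val_inj => /=.
by have := ltn_ord i; have := ltn_ord j; lia.
Qed.

Lemma anc_refl v : anc par v v.
Proof. exact: connect0. Qed.

Lemma anc_eqVstrict u v : anc par u v = (v == u) || (anc par u v && (u != v)).
Proof. by case: eqVneq => [->|_]; rewrite ?anc_refl ?andbT. Qed.

Lemma anc_trans u v w : anc par u v -> anc par v w -> anc par u w.
Proof. by rewrite /anc => vu wv; apply: connect_trans vu. Qed.

Lemma anc_parent v : anc par (par v) v.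
Proof. exact: (fconnect_iter par 1). Qed.

Lemma anc_step u v : anc par u v -> u != v -> 0 < d v /\ anc par u (par v).
Proof.
move=> /iter_findex; case: (findex _ _ _) => [/= ->|j]; first by rewrite eqxx.
rewrite iterSr => <- uv; split; last exact: fconnect_iter.
rewrite lt0n (depth_eq0 rk); apply: contraNneq uv => ->.
by rewrite -iterSr; elim: j.+1 => //= i /eqP->; rewrite parent_root.
Qed.

Lemma anc_root v : anc par r v.
Proof.
by elim/parent_ind: v => [|v _ rv]; [exact: anc_refl|exact: anc_trans rv (anc_parent v)].
Qed.

Lemma anc_depth_lt u v : anc par u v -> u != v -> d u < d v.
Proof.
elim/parent_ind: v => [ur ne|v dv IH uv ne]; first by have [] := anc_step ur ne; rewrite depth_root.
have [_ /IH] := anc_step uv ne; rewrite (depth_parent rk).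
by case: eqVneq => [->|_ /(_ isT)]; rewrite ?(depth_parent rk); lia.
Qed.

Lemma anc_depth_le u v : anc par u v -> d u <= d v.
Proof. by case: (eqVneq u v) => [->//|ne /anc_depth_lt/(_ ne)/ltnW]. Qed.

Lemma anc_anti u v : anc par u v -> d v <= d u -> u = v.
Proof.
by move=> uv dvu; apply/eqP; apply: contraTT dvu => ne; rewrite -ltnNge anc_depth_lt.
Qed.

Lemma anc_linear u v w : anc par u w -> anc par v w -> d u <= d v -> anc par u v.
Proof.
elim/parent_ind: w => [ur vr _|w dw IH uw vw duv].
  by rewrite (anc_anti vr) ?depth_root.
case: (eqVneq v w) => [->//|vnw]; have [_ vpw] := anc_step vw vnw; apply: IH => //.
case: (eqVneq u w) => [euw|/(anc_step uw)[]//].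
by have := anc_depth_lt vw vnw; rewrite -euw; lia.
Qed.

Variable ch : T -> seq T.
Hypothesis chP : children par d ch.

Lemma depth_child p c : c \in ch p -> d c = (d p).+1.
Proof.
by rewrite (mem_children chP) => /andP[dc /eqP<-]; rewrite (depth_parent rk) prednK.
Qed.

Lemma anc_child p c : c \in ch p -> anc par p c.
Proof. by rewrite (mem_children chP) => /andP[_ /eqP<-]; exact: anc_parent. Qed.

Let height := \max_v d v.

Lemma children_ind (P : T -> Prop) :
  (forall p, {in ch p, forall c, P c} -> P p) -> forall p, P p.
Proof.
move=> Pch p; move: {2}(height - d p) (leqnn (height - d p)) => m.
elim: m p => [|m IH] p pm; apply: Pch => c /depth_child dc.
  by have := @leq_bigmax _ d c; rewrite -/height; lia.
by apply: IH; lia.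
Qed.

Lemma strictly_below_child p w : anc par p w && (p != w) = has (fun c => anc par c w) (ch p).
Proof.
apply/andP/hasP => [[]|[c cp cw]]; last first.
  have pc := anc_child cp; split; first exact: anc_trans cw.
  by apply: contraTneq (anc_depth_le cw) => <-; rewrite (depth_child cp) -ltnNge.
elim/parent_ind: w => [pr pnr|w dw IH pw pnw].
  by have := anc_depth_lt pr pnr; rewrite depth_root.
case: (eqVneq p (par w)) => [->|pnpw].
  by exists w; rewrite ?anc_refl // (mem_children chP) dw /=.
have [_ /IH/(_ pnpw)[c cp cpw]] := anc_step pw pnw.
by exists c => //; apply: anc_trans cpw (anc_parent w).
Qed.

Fixpoint unfold_forest m p : btree T :=
  if m is m'.+1 then graft (unfold_forest m') (ch p) else Leaf.

(* The strict descendants of [p]. *)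
Definition subforest p := unfold_forest (height - d p) p.

Lemma subforestE p : subforest p = graft subforest (ch p).
Proof.
rewrite {1}/subforest; case below_p: (height - d p) => [|m] /=.
  case ch_p: (ch p) => [//|c s]; have cp : c \in ch p by rewrite ch_p mem_head.
  by have := @leq_bigmax _ d c; rewrite -/height (depth_child cp); lia.
by apply: eq_in_graft => c cp; rewrite /subforest (depth_child cp) subnS below_p.
Qed.

Definition spanning_tree := Node r (subforest r) Leaf.

Lemma mem_subforest p w : (w \in nodes (subforest p)) = anc par p w && (p != w).
Proof.
elim/children_ind: p => p IH; rewrite subforestE mem_nodes_graft strictly_below_child.
by apply: eq_in_has => c /IH->; rewrite -anc_eqVstrict.
Qed.

Lemma uniq_subforest p : uniq (nodes (subforest p)).
Proof.
elim/children_ind: p => p IH; rewrite subforestE.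
have below c w : (w == c) || (w \in nodes (subforest c)) = anc par c w.
  by rewrite mem_subforest -anc_eqVstrict.
have := uniq_children chP p; have := @depth_child p.
elim: (ch p) IH => //= c s IHs IH dch /andP[cs us].
have disjoint w : anc par c w -> w \notin nodes (graft subforest s).
  move=> cw; rewrite mem_nodes_graft; apply/hasPn => c' c's; rewrite below.
  apply: contraNN cs => c'w; rewrite (_ : c = c') //.
  have dcc' : d c = d c' by rewrite (dch c) ?(dch c') ?inE ?eqxx ?c's ?orbT.
  by apply: anc_anti (anc_linear cw c'w _) _; rewrite dcc'.
rewrite mem_cat negb_or mem_subforest eqxx andbF disjoint ?anc_refl //=.
rewrite cat_uniq IH ?mem_head // IHs // => [|c' c's|c' c's]; last first.
- by apply: dch; rewrite inE c's orbT.
- by apply: IH; rewrite inE c's orbT.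
by rewrite andbT; apply/hasPn => w; apply: contraL => /= wc; rewrite disjoint // -below wc orbT.
Qed.

Lemma run_subforest A (M : automaton A) (f : T -> A) (st : T -> state M) :
  (forall p, st p = run_forest f st (ch p)) <->
  (forall p, st p = run M (btree_map f (subforest p))).
Proof.
split=> stP p; last by rewrite stP subforestE run_graft; apply: eq_in_run_forest.
elim/children_ind: p => p IH; rewrite stP subforestE run_graft.
exact: eq_in_run_forest.
Qed.

End RankedTree.

(** * Locally checkable certificates of elimination trees *)

(* [bag v a] is the vertex of color [a] in [str v], if there is one. *)
Record elim_certificate n K := ElimCertificate {
  parent : 'I_n.+1 -> 'I_n.+1;
  depth : 'I_n.+1 -> nat;
  tree_root : 'I_n.+1;
  color : 'I_n.+1 -> 'I_K;
  bag : 'I_n.+1 -> 'I_K -> option 'I_n.+1 }.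

Record certifies n K (D : elim_certificate n K) (G : graph n) : Prop := Certifies {
  certifies_ranked : ranked (parent D) (depth D) (tree_root D);
  bag_color v : bag D v (color D v) = Some v;
  bag_root a u : bag D (tree_root D) a = Some u -> a = color D (tree_root D);
  depth_adj u v : adj G u v -> depth D u != depth D v;
  bag_adj u v : adj G u v -> depth D u < depth D v -> bag D v (color D u) = Some u;
  bag_parent v a u : 0 < depth D v -> a != color D v ->
    bag D v a = Some u -> bag D (parent D v) a = Some u }.

Definition nbr_colors n K (D : elim_certificate n K) (G : graph n) v : {set 'I_K} :=
  [set a | oapp (adj G v) false (bag D v a)].

Section Certificate.
Variables (n K : nat) (G : graph n) (D : elim_certificate n K).
Hypothesis DG : certifies D G.
Local Notation par := (parent D).
Local Notation d := (depth D).

Let rk : ranked par d (tree_root D) := certifies_ranked DG.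

Lemma bag_other_color v a u : bag D v a = Some u -> u != v -> a != color D v.
Proof.
by move=> bva; apply: contraNneq => ea; move: bva; rewrite ea (bag_color DG) => -[<-].
Qed.

Lemma bag_sound v a u : bag D v a = Some u -> anc par u v /\ color D u = a.
Proof.
have own w : bag D w a = Some u -> a = color D w -> anc par u w /\ color D u = a.
  by move=> bwa ea; move: bwa; rewrite ea (bag_color DG) => -[<-]; split=> //; apply: anc_refl.
elim/(parent_ind rk): v => [bra|v dv IH bva]; first exact: own bra (bag_root DG bra).
case: (eqVneq a (color D v)) => [/(own v bva)//|ne].
have [upv ua] := IH (bag_parent DG dv ne bva).
by split=> //; apply: anc_trans upv (anc_parent par v).
Qed.

(* Going up from [w], the color [a] cannot be met before [u]. *)
Lemma bag_up w a u v : bag D w a = Some u -> anc par v w -> d u <= d v -> bag D v a = Some u.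
Proof.
elim/(parent_ind rk): w => [|w dw IH] bwa vw duv.
  by rewrite (anc_anti rk vw) ?(depth_root rk).
case: (eqVneq v w) => [->//|vnw]; have [_ vpw] := anc_step rk vw vnw.
apply: IH => //; apply: (bag_parent DG) => //; apply: (bag_other_color bwa).
by apply: contraTneq duv => ->; rewrite -ltnNge (anc_depth_lt rk).
Qed.

Lemma adj_anc u v : adj G u v -> d u < d v -> anc par u v.
Proof. by move=> uv /(bag_adj DG uv)/bag_sound[]. Qed.

Lemma adj_comparable u v : adj G u v -> anc par u v || anc par v u.
Proof.
move=> uv; have := depth_adj DG uv; case: ltngtP => // [/(adj_anc uv)->//|dvu _].
by rewrite (adj_anc _ dvu) ?orbT // adj_sym.
Qed.

Lemma bag_str C v u : u \in str G C par v -> bag D v (color D u) = Some u.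
Proof.
rewrite inE => /orP[/eqP->|/and3P[unv uv /exists_inP[w]]]; first exact: (bag_color DG).
rewrite inE => /andP[_ vw] uw; have duv := anc_depth_lt rk uv unv.
have bw := bag_adj DG uw (leq_trans duv (anc_depth_le rk vw)).
exact: bag_up bw vw (ltnW duv).
Qed.

Lemma card_str C v : #|str G C par v| <= K.
Proof.
rewrite -[leqRHS]card_ord; apply: (leq_card_in (color D)) => u u' us us' euu'.
by have := bag_str us; rewrite euu' (bag_str us') => -[].
Qed.

Lemma certifies_elim_tree : is_elim_tree G [set: 'I_n.+1] par (tree_root D).
Proof.
by split=> [||v _|v _|u v _ _ /adj_comparable]; rewrite ?inE ?(parent_root rk) ?(anc_root rk).
Qed.

Variable ch : 'I_n.+1 -> seq 'I_n.+1.
Hypothesis chP : children par d ch.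

Definition certificate_label v : node_label K := (color D v, nbr_colors D G v).
Local Notation l := certificate_label.

Lemma dangling_subforest p a w :
  dangling l (subforest d ch p) a w =
  [&& anc par p w, p != w & oapp (adj G w) false (bag D p a)].
Proof.
elim/(children_ind rk chP): p => p IH; rewrite (subforestE rk chP) dangling_graft.
rewrite andbA (strictly_below_child rk chP); apply/hasP/andP => [[c cp]|].
  have bag_p u : a != color D c -> bag D c a = Some u -> bag D p a = Some u.
    move: cp; rewrite (mem_children chP) => /andP[dc /eqP<-].
    exact: (bag_parent DG dc).
  rewrite IH // => /orP[/andP[/eqP-> ]|/and4P[ac cw cnw]].
    rewrite inE; case bca: (bag D c a) => [u|] //= cu.
    split; first by apply/hasP; exists c => //; apply: anc_refl.
    rewrite (bag_p u) //; apply: (bag_other_color bca).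
    by apply: contraTneq cu => ->; rewrite adj_irr.
  case bca: (bag D c a) => [u|] //= wu.
  by split; [apply/hasP; exists c|rewrite (bag_p u)].
case=> /hasP[c cp cw]; case bpa: (bag D p a) => [u|] //= wu; exists c => //.
have [up ua] := bag_sound bpa.
have duc : d u < d c by rewrite (depth_child rk chP cp) ltnS (anc_depth_le rk).
have bwa : bag D w a = Some u.
  by rewrite -ua (bag_adj DG) 1?adj_sym // (leq_trans duc) ?(anc_depth_le rk).
have bca := bag_up bwa cw (ltnW duc).
rewrite IH // cw bca /= wu andbT inE; case: eqVneq => [<-|_] /=; first by rewrite bwa /= wu.
by rewrite andbT (bag_other_color bca) //; apply: contraTneq duc => ->; rewrite ltnn.
Qed.

Lemma down_edge_subforest p u w :
  down_edge l (subforest d ch p) u w = [&& anc par p u, p != u, anc par u w & adj G u w].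
Proof.
elim/(children_ind rk chP): p => p IH; rewrite (subforestE rk chP) down_edge_graft.
rewrite andbA (strictly_below_child rk chP).
have -> b : has (fun c => anc par c u) (ch p) && b = has (fun c => anc par c u && b) (ch p).
  by elim: (ch p) => //= c s <-; rewrite andb_orl.
apply: eq_in_has => c cp; rewrite IH // dangling_subforest (bag_color DG) /= [adj G w c]adj_sym.
rewrite (anc_eqVstrict _ c u); case: eqVneq => [->|_] /=; last by rewrite andbA.
by rewrite orbF; case: eqVneq => [->|//]; rewrite adj_irr andbF.
Qed.

Lemma spanning_tree_encodes : encodes (spanning_tree d (tree_root D) ch) l G.
Proof.
have below_root v : v \in nodes (spanning_tree d (tree_root D) ch).
  rewrite /= inE cats0 (mem_subforest rk chP) (anc_root rk) /=.
  by rewrite eq_sym; case: eqVneq.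
have down_edgeE u w : down_edge l (spanning_tree d (tree_root D) ch) u w = anc par u w && adj G u w.
  rewrite /= orbF dangling_subforest down_edge_subforest (bag_color DG) /= [adj G w _]adj_sym.
  rewrite !(anc_root rk) /=; case: eqVneq => [->|_] /=; last by [].
  by rewrite (anc_root rk) orbF; case: eqVneq => [->|//]; rewrite adj_irr.
split=> [|//|u v].
  rewrite /= cats0 (uniq_subforest rk chP) andbT (mem_subforest rk chP).
  by rewrite eqxx andbF.
rewrite !down_edgeE (adj_sym G v) -andb_orl.
by case uv: (adj G u v); rewrite ?andbF // adj_comparable.
Qed.

(* [models] sends every point variable to the vertex 0 and every set variable to
   the empty set. *)
Definition certificate_letter v : letter K :=
  Letter (certificate_label v) (fun=> 0 == val v) (fun=> false).

Lemma models_run (M : automaton (letter K)) (psi : mso) (st : 'I_n.+1 -> state M) :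
  decides M psi ->
  (forall p, st p = run_forest certificate_letter st (ch p)) ->
  models G psi <-> final (step (certificate_letter (tree_root D)) (st (tree_root D)) (init M)).
Proof.
move=> Mpsi /(run_subforest rk chP) stE; rewrite /models (Mpsi _ _ _ _ spanning_tree_encodes).
have -> : valued_letter l (fun=> ord0) (fun=> set0) = certificate_letter.
  by apply/funext=> v; congr Letter; apply/funext=> i; rewrite inE.
by rewrite /accepted /= stE.
Qed.

End Certificate.

(** * Existence of certificates *)

Lemma greedy_coloring (T : finType) (d : T -> nat) (B : T -> {set T}) k :
  (forall u v, u \in B v -> d u < d v) -> (forall v, #|B v| <= k) ->
  exists col : T -> 'I_k.+1, forall u v, u \in B v -> col u != col v.
Proof.
move=> dB cardB; have upto m : exists col : T -> 'I_k.+1,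
    forall u v, d v < m -> u \in B v -> col u != col v; last first.
  have [col colP] := upto (\max_v d v).+1; exists col => u v uv.
  by apply: colP uv; rewrite ltnS; apply: leq_bigmax.
elim: m => [|m [col colP]]; first by exists (fun=> ord0).
have /choice[new newP] v : exists a, a \notin [set col u | u in B v].
  apply/existsP; rewrite -negb_forall; apply: contraL (cardB v) => /forallP full.
  rewrite -ltnNge -[k.+1]card_ord; apply: leq_trans (leq_imset_card col _).
  by apply/subset_leq_card/subsetP.
exists (fun v => if d v == m then new v else col v) => u v; rewrite ltnS => dv uv.
have du := dB _ _ uv; have -> /= : (d u == m) = false by lia.
case: (d v =P m) => [_|ne]; last by apply: colP => //; lia.
by apply: contraNneq (newP v) => <-; apply: imset_f.
Qed.

Section CertificateExists.
Variables (n k : nat) (G : graph n) (par : 'I_n.+1 -> 'I_n.+1) (d : 'I_n.+1 -> nat).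
Variable r : 'I_n.+1.
Hypothesis rk : ranked par d r.
Hypothesis adj_comparable : forall u v, adj G u v -> anc par u v || anc par v u.
Local Notation strT := (str G [set: 'I_n.+1] par).
Hypothesis str_card : forall v, #|strT v| <= k.+1.

Lemma mem_str u v : u \in strT v <->
  u = v \/ [/\ u != v, anc par u v & exists2 w, anc par v w & adj G u w].
Proof.
rewrite inE; split=> [/orP[/eqP|/and3P[unv uv /exists_inP[w]]]|]; first by left.
  by rewrite !inE => vw uw; right; split=> //; exists w.
case=> [->|[unv uv [w vw uw]]]; first by rewrite eqxx.
by rewrite unv uv orbC; apply/orP; left; apply/exists_inP; exists w; rewrite ?inE.
Qed.

Lemma str_self v : v \in strT v.
Proof. by apply/mem_str; left. Qed.

Lemma anc_of_str u v : u \in strT v -> anc par u v.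
Proof. by case/mem_str=> [->|[]//]; apply: anc_refl. Qed.

Lemma str_between u x v : u \in strT v -> anc par u x -> anc par x v -> u \in strT x.
Proof.
case: (eqVneq u x) => [->|unx]; first by rewrite str_self.
move=> /mem_str[->|[_ _ [w vw uw]]] ux xv.
  by rewrite (anc_anti rk xv) ?str_self // (anc_depth_le rk).
by apply/mem_str; right; split=> //; exists w => //; apply: anc_trans vw.
Qed.

Lemma proper_coloring_inj_str (A : eqType) (col : 'I_n.+1 -> A) v :
  (forall u v, u \in strT v :\ v -> col u != col v) -> {in strT v &, injective col}.
Proof.
move=> colP u u' us us' euu'; have [uv u'v] := (anc_of_str us, anc_of_str us').
wlog du : u u' us us' euu' uv u'v / d u <= d u'.
  by case: (leqP (d u) (d u')) => [|/ltnW] du th; [|symmetry]; apply: th.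
apply/eqP; apply: contraT => ne; have uu' := anc_linear rk uv u'v du.
by have := colP u u'; rewrite euu' eqxx in_setD1 ne (str_between us uu' u'v) => /(_ isT).
Qed.

Lemma certificate_exists : exists D : elim_certificate n k.+1,
  [/\ certifies D G, parent D = par & tree_root D = r].
Proof.
have [||col colP] := @greedy_coloring _ d (fun v => strT v :\ v) k.
- move=> u v; rewrite in_setD1 => /andP[ne us]; exact: (anc_depth_lt rk (anc_of_str us) ne).
- by move=> v; have := str_card v; rewrite (cardsD1 v (strT v)) str_self.
pose bag v a := [pick u in strT v | col u == a].
have bagP v a u : bag v a = Some u <-> u \in strT v /\ col u = a.
  rewrite /bag; case: pickP => [w /andP[ws /eqP wa]|none]; split=> //.
  - by case=> <-.
  - by case=> us ua; congr Some; apply: (proper_coloring_inj_str (v := v) colP); rewrite // wa ua.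
  - by case=> us /eqP ua; have := none u; rewrite us ua.
exists (ElimCertificate par d r col bag); split=> //; split=> //=.
- by move=> v; apply/bagP; split=> //; apply: str_self.
- by move=> a u /bagP[/anc_of_str ur <-]; rewrite (anc_anti rk ur) ?(depth_root rk).
- move=> u v uv; have ne : u != v by apply: contraTneq uv => ->; rewrite adj_irr.
  rewrite neq_ltn; case/orP: (adj_comparable uv) => /(anc_depth_lt rk)->; rewrite ?orbT //.
  by rewrite eq_sym.
- move=> u v uv duv; apply/bagP; split=> //; apply/mem_str; right.
  have ne : u != v by apply: contraTneq uv => ->; rewrite adj_irr.
  split=> //; last by exists v => //; apply: anc_refl.
  by case/orP: (adj_comparable uv) => // /(anc_depth_le rk); rewrite leqNgt duv.
- move=> v a u dv ne /bagP[us ua]; apply/bagP; split=> //.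
  have unv : u != v by apply: contraNneq ne => <-; rewrite ua.
  have [_ upv] := anc_step rk (anc_of_str us) unv.
  exact: (str_between us upv (anc_parent par v)).
Qed.

End CertificateExists.

Definition descends (T : eqType) (e : rel T) (z : T) (h : T -> nat) :=
  forall v, v != z -> exists2 w, e v w & h v = (h w).+1.

Lemma descends_connect (T : finType) (e : rel T) z h v : descends e z h -> connect e v z.
Proof.
move=> hz; move: {2}(h v) (leqnn (h v)) => m; elim: m v => [|m IH] v hv.
all: case: (eqVneq v z) => [->|/hz[w vw hw]]; first exact: connect0.
  by rewrite hw in hv.
by apply: connect_trans (connect1 vw) (IH w _); rewrite hw in hv.
Qed.

Lemma descends_exists (T : finType) (e : rel T) z : (forall v, connect e v z) ->
  exists h : T -> nat, [/\ descends e z h, h z = 0 & forall v, h v < #|T|].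
Proof.
move=> ez; pose to_z v m := `[< exists p, [/\ path e v p, last v p = z & size p = m] >].
have ex_to_z v : exists m, to_z v m.
  by have /connectP[p vp lp] := ez v; exists (size p); apply/asboolP; exists p.
pose h v := ex_minn (ex_to_z v).
have hP v : exists p, [/\ path e v p, last v p = z & size p = h v].
  by rewrite /h; case: ex_minnP => m /asboolP.
have h_min v p : path e v p -> last v p = z -> h v <= size p.
  by rewrite /h; case: ex_minnP => m _ min vp lp; apply: min; apply/asboolP; exists p.
exists h; split=> [v vz||v].
- have [[|w p] [/= vp lp sp]] := hP v; first by rewrite lp eqxx in vz.
  case/andP: vp => vw wp; exists w => //; apply/eqP; rewrite eqn_leq.
  rewrite -{2}sp ltnS h_min // andbT.
  have [p' [wp' lp' <-]] := hP w; exact: (h_min v (w :: p')) (introT andP (conj vw wp')) lp'.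
- by apply/eqP; rewrite -leqn0 (h_min z [::]).
- have /connectP[p vp lp] := ez v; case/shortenP: vp lp => p' vp' up' _ /esym lp'.
  apply: leq_ltn_trans (h_min _ _ vp' lp') _.
  by have := max_card (mem (v :: p')); rewrite (card_uniqP up').
Qed.

Lemma ranked_exists (T : finType) (par : T -> T) r :
  par r = r -> (forall v, anc par r v) -> exists d, ranked par d r.
Proof.
move=> parr /descends_exists[d [dr d0 _]]; exists d; split=> v.
  case: (eqVneq v r) => [->|/dr[w _ ->]//]; by rewrite d0.
by case: (eqVneq v r) => [->|/dr[w /eqP<- ->]//]; rewrite parr d0.
Qed.

(** * Routing the remote children *)

Definition remote n K (D : elim_certificate n K) (G : graph n) :=
  [seq c <- enum 'I_n.+1 | (0 < depth D c) && ~~ adj G c (parent D c)].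

(* [c :: route c] consists of the starting and internal vertices of the path
   from [c] to its parent. *)
Definition routing n K (D : elim_certificate n K) (G : graph n) k
    (route : 'I_n.+1 -> seq 'I_n.+1) :=
  {in remote D G, forall c, is_opath G (rcons (c :: route c) (parent D c))} /\
  forall v, count (fun c => v \in c :: route c) (remote D G) <= k.

Lemma mem_remote n K (D : elim_certificate n K) (G : graph n) c :
  (c \in remote D G) = (0 < depth D c) && ~~ adj G c (parent D c).
Proof. by rewrite mem_filter mem_enum andbT. Qed.

Lemma uniq_remote n K (D : elim_certificate n K) (G : graph n) : uniq (remote D G).
Proof. by rewrite filter_uniq ?enum_uniq. Qed.

Lemma opath_start_or_internal n (G : graph n) x s y v (P := rcons (x :: s) y) :
  is_opath G P -> (v \in P) && ((v == head v P) || (v != last v P)) = (v \in x :: s).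
Proof.
case/andP=> _; rewrite /P rcons_uniq => /andP[yP _]; rewrite last_rcons mem_rcons inE /=.
case: (eqVneq v y) => [->|_] /=; last by rewrite orbT andbT.
by rewrite (negbTE yP) orbF; apply: contraNF yP => /eqP->; apply: mem_head.
Qed.

Lemma routing_witnesses n K (D : elim_certificate n K) (G : graph n) k route C :
  certifies D G -> routing D G k route ->
  exists ps, [/\ opath_system G ps, forall v, congestion_at ps v <= k &
    witnesses G C (parent D) (tree_root D) ps].
Proof.
move=> DG [opath_route congestion].
exists [seq rcons (c :: route c) (parent D c) | c <- remote D G]; split.
- apply/andP; split; first by apply/allP=> _ /mapP[c cr ->]; apply: opath_route.
  by rewrite map_inj_uniq ?uniq_remote // => c c' [].
- move=> v; rewrite /congestion_at count_map; apply: leq_trans (congestion v).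
  by apply/eq_leq/eq_in_count => c cr; apply: opath_start_or_internal (opath_route c cr).
- move=> v _ vr; case: (boolP (adj G v (parent D v))) => [|nv]; [by left|right].
  exists (route v); apply/mapP; exists v => //.
  by rewrite mem_remote nv lt0n (depth_eq0 (certifies_ranked DG)) vr.
Qed.

Lemma witnesses_routing n K (D : elim_certificate n K) (G : graph n) k ps :
  certifies D G -> opath_system G ps -> (forall v, congestion_at ps v <= k) ->
  witnesses G [set: 'I_n.+1] (parent D) (tree_root D) ps -> exists route, routing D G k route.
Proof.
move=> DG /andP[/allP ps_opath ps_uniq] congestion ps_witnesses.
have /choice[route routeP] c : exists s, c \in remote D G -> rcons (c :: s) (parent D c) \in ps.
  case: (boolP (c \in remote D G)) => [|_]; last by exists [::].
  rewrite mem_remote lt0n (depth_eq0 (certifies_ranked DG)) => /andP[cr nc].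
  by have [cp|[s sps]] := ps_witnesses c (in_setT c) cr; [rewrite cp in nc|exists s].
exists route; split=> [c /routeP/ps_opath//|v]; apply: leq_trans (congestion v).
rewrite -size_filter -(size_map (fun c => rcons (c :: route c) (parent D c))).
rewrite /congestion_at -size_filter; apply: uniq_leq_size.
  by rewrite map_inj_uniq => [|c c' []//]; exact/filter_uniq/uniq_remote.
move=> P /mapP[c]; rewrite mem_filter => /andP[vc /routeP cps] ->{P}.
by rewrite mem_filter cps andbT (opath_start_or_internal _ (ps_opath _ cps)).
Qed.

Lemma lvtw_le_ge0 n (G : graph n) (w : int) : lvtw_le G w -> (0 <= w)%R.
Proof.
case/(_ ord0)=> par [r [ps [[rC _ _ _ _] /(_ r rC) width _ _ _]]].
have : 0 < #|str G (component G ord0) par r|.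
  by apply/card_gt0P; exists r; rewrite inE eqxx.
by lia.
Qed.

Theorem lvtw_certificateP n (G : graph n) k : connectedG G ->
  lvtw_le G k%:Z <->
  exists (D : elim_certificate n k.+1) route, certifies D G /\ routing D G k route.
Proof.
move=> cG; have compT x : component G x = [set: 'I_n.+1] by apply/setP=> y; rewrite !inE cG.
split=> [/(_ ord0)|[D [route [DG DR]]] x]; rewrite compT; last first.
  have [ps [ps_opath congestion ps_witnesses]] := routing_witnesses [set: 'I_n.+1] DG DR.
  exists (parent D), (tree_root D), ps; split=> //; first exact: certifies_elim_tree.
  by move=> v _; have := card_str DG [set: 'I_n.+1] v; lia.
case=> par [r [ps [[_ parr _ anc_r comparable] width ps_opath congestion ps_witnesses]]].
have [d rk] := ranked_exists parr (fun v => anc_r v (in_setT v)).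
have [|v|D [DG Dpar Droot]] := @certificate_exists n k G par d r rk.
- by move=> u v; apply: comparable; rewrite inE.
- by have := width v (in_setT v); lia.
have [route DR] : exists route, routing D G k route.
  by apply: (witnesses_routing DG ps_opath); rewrite ?Dpar ?Droot.
by exists D, route.
Qed.

(** * Prefix codes *)

Definition prefix_code T (c : T -> bitseq) :=
  forall x y r s, c x ++ r = c y ++ s -> x = y /\ r = s.

Lemma prefix_code_inj T (c : T -> bitseq) : prefix_code c -> injective c.
Proof. by move=> cP x y cxy; have [] := cP x y [::] [::]; rewrite ?cxy. Qed.

Lemma prefix_code_comp T U (c : T -> bitseq) (f : U -> T) :
  prefix_code c -> injective f -> prefix_code (c \o f).
Proof. by move=> cP f_inj x y r s /cP[/f_inj]. Qed.

Definition code_pair T U (c : T -> bitseq) (c' : U -> bitseq) (x : T * U) := c x.1 ++ c' x.2.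

Lemma prefix_code_pair T U (c : T -> bitseq) (c' : U -> bitseq) :
  prefix_code c -> prefix_code c' -> prefix_code (code_pair c c').
Proof.
move=> cP c'P [x x'] [y y'] r s; rewrite /code_pair -!catA.
by case/cP=> /= -> /c'P[-> ->].
Qed.

Lemma size_code_pair T U (c : T -> bitseq) (c' : U -> bitseq) x y :
  size (code_pair c c' (x, y)) = size (c x) + size (c' y).
Proof. exact: size_cat. Qed.

Fixpoint code_seq T (c : T -> bitseq) s : bitseq :=
  if s is x :: s' then true :: c x ++ code_seq c s' else [:: false].

Lemma prefix_code_seq T (c : T -> bitseq) : prefix_code c -> prefix_code (code_seq c).
Proof.
move=> cP; elim=> [|x s IH] [|y t] r r' //=; first by case.
by rewrite -!catA => -[/cP[-> /IH[-> ->]]].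
Qed.

Lemma size_code_seq (T : eqType) (c : T -> bitseq) s b :
  {in s, forall x, size (c x) <= b} -> size (code_seq c s) <= size s * b.+1 + 1.
Proof.
elim: s => //= x s IH sb; rewrite size_cat mulSn.
have := sb x (mem_head _ _); have : size (code_seq c s) <= size s * b.+1 + 1.
  by apply: IH => y ys; apply: sb; rewrite inE ys orbT.
by lia.
Qed.

Fixpoint binary m x : bitseq := if m is m'.+1 then odd x :: binary m' x./2 else [::].

Lemma size_binary m x : size (binary m x) = m.
Proof. by elim: m x => //= m IH x; rewrite IH. Qed.

Lemma binary_cat_inj m x y r s : x < 2 ^ m -> y < 2 ^ m ->
  binary m x ++ r = binary m y ++ s -> x = y /\ r = s.
Proof.
elim: m x y => [|m IH] x y /=; first by case: x; case: y.
rewrite !expnS => xm ym [odd_xy /IH[]]; try lia.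
by move=> half_xy ->; rewrite -(odd_double_half x) odd_xy half_xy odd_double_half.
Qed.

Definition num_bits n := (trunc_log 2 n).+1.

Definition code_nat x : bitseq := nseq (num_bits x) true ++ false :: binary (num_bits x) x.

Lemma prefix_code_nat : prefix_code code_nat.
Proof.
have unary_inj a b (r s : bitseq) :
    nseq a true ++ false :: r = nseq b true ++ false :: s -> a = b /\ r = s.
  by elim: a b => [|a IH] [|b] //= []; [|case/IH=> ->].
have lt_num_bits x : x < 2 ^ num_bits x by apply: trunc_log_ltn.
move=> x y r s; rewrite /code_nat; move: (num_bits x) (num_bits y) (lt_num_bits x) (lt_num_bits y).
move=> m m' xm ym; rewrite -!catA !cat_cons => /unary_inj[em]; rewrite em in xm *.
exact: binary_cat_inj.
Qed.

Lemma size_code_nat n x : x <= n -> size (code_nat x) <= 3 * num_bits n.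
Proof.
by move=> /(leq_trunc_log 2); rewrite size_cat size_nseq /= size_binary /num_bits; lia.
Qed.

Definition code_fin (T : finType) (x : T) := code_nat (enum_rank x).

Lemma prefix_code_fin (T : finType) : prefix_code (@code_fin T).
Proof.
by apply: (prefix_code_comp prefix_code_nat) => x y /val_inj; apply: enum_rank_inj.
Qed.

Lemma size_code_fin (T : finType) (x : T) : size (code_fin x) <= 3 * num_bits #|T|.
Proof. exact/size_code_nat/ltnW/ltn_ord. Qed.

Definition code_option (x : option nat) := code_nat (oapp S 0 x).

Lemma prefix_code_option : prefix_code code_option.
Proof. by apply: (prefix_code_comp prefix_code_nat) => -[x|] [y|] //= [->]. Qed.

Definition code_ffun (T : finType) U (c : U -> bitseq) (f : {ffun T -> U}) := code_seq c (codom f).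

Lemma prefix_code_ffun (T : finType) U (c : U -> bitseq) :
  prefix_code c -> prefix_code (@code_ffun T U c).
Proof.
move=> cP; apply: (prefix_code_comp (prefix_code_seq cP)) => f g fg.
by apply: (can_inj fgraphK); apply: val_inj; rewrite !fgraph_codom.
Qed.

Lemma size_code_ffun (T : finType) (U : eqType) (c : U -> bitseq) (f : {ffun T -> U}) b :
  (forall x, size (c (f x)) <= b) -> size (code_ffun c f) <= #|T| * b.+1 + 1.
Proof.
by move=> fb; rewrite -(size_codom f); apply: size_code_seq => _ /codomP[x ->].
Qed.

(** * Vertex labels *)

(* Identifiers are shifted to start from 0, and the root is its own parent. *)
Record info K (Q : finType) := Info {
  info_id : nat;
  info_parent : nat;
  info_depth : nat;
  info_color : 'I_K;
  info_nbr_colors : {set 'I_K};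
  info_state : Q;
  info_bag : {ffun 'I_K -> option nat} }.

Definition info_tuple K Q (inf : info K Q) :=
  (info_id inf, info_parent inf, info_depth inf,
   (info_color inf, info_nbr_colors inf, info_state inf), info_bag inf).

Definition tuple_info K Q t : info K Q :=
  let: (i, p, d, (a, N, q), b) := t in Info i p d a N q b.

Lemma info_tupleK K Q : cancel (@info_tuple K Q) (@tuple_info K Q).
Proof. by case. Qed.

HB.instance Definition _ K Q := Equality.copy (info K Q) (can_type (@info_tupleK K Q)).

(* A copy of the information of a vertex, carried along the path to its parent
   and held by the internal vertex after [travelled] edges; [remaining] internal
   vertices follow. *)
Record relay K Q := Relay { cargo : info K Q; travelled : nat; remaining : nat }.

Definition relay_tuple K Q (e : relay K Q) := (cargo e, travelled e, remaining e).

Definition tuple_relay K Q t : relay K Q := let: (inf, i, j) := t in Relay inf i j.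

Lemma relay_tupleK K Q : cancel (@relay_tuple K Q) (@tuple_relay K Q).
Proof. by case. Qed.

HB.instance Definition _ K Q := Equality.copy (relay K Q) (can_type (@relay_tupleK K Q)).

(* [distance] is the distance to the vertex 0. *)
Record label K Q := Label {
  own_info : info K Q;
  root_id : nat;
  distance : nat;
  relays : seq (relay K Q) }.

Definition label_tuple K Q (L : label K Q) := (own_info L, root_id L, distance L, relays L).

Lemma label_tuple_inj K Q : injective (@label_tuple K Q).
Proof. by move=> [? ? ? ?] [? ? ? ?] [-> -> -> ->]. Qed.

Section LabelCode.
Variables (K : nat) (Q : finType).

Definition code_info : info K Q -> bitseq :=
  code_pair (code_pair (code_pair (code_pair code_nat code_nat) code_nat) (@code_fin _))
    (code_ffun code_option) \o @info_tuple K Q.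

Definition code_relay : relay K Q -> bitseq :=
  code_pair (code_pair code_info code_nat) code_nat \o @relay_tuple K Q.

Definition code_label : label K Q -> bitseq :=
  code_pair (code_pair (code_pair code_info code_nat) code_nat) (code_seq code_relay)
    \o @label_tuple K Q.

Lemma prefix_code_info : prefix_code code_info.
Proof.
apply: prefix_code_comp (can_inj (@info_tupleK K Q)).
apply/prefix_code_pair/prefix_code_ffun/prefix_code_option.
apply/prefix_code_pair/prefix_code_fin.
exact/prefix_code_pair/prefix_code_nat/prefix_code_pair/prefix_code_nat/prefix_code_nat.
Qed.

Lemma prefix_code_relay : prefix_code code_relay.
Proof.
apply: prefix_code_comp (can_inj (@relay_tupleK K Q)).
exact/prefix_code_pair/prefix_code_nat/prefix_code_pair/prefix_code_nat/prefix_code_info.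
Qed.

Lemma code_label_inj : injective code_label.
Proof.
apply/prefix_code_inj/prefix_code_comp/label_tuple_inj.
apply/prefix_code_pair/prefix_code_seq/prefix_code_relay.
exact/prefix_code_pair/prefix_code_nat/prefix_code_pair/prefix_code_nat/prefix_code_info.
Qed.

Definition info_bounded n (inf : info K Q) :=
  [/\ info_id inf <= n, info_parent inf <= n, info_depth inf <= n &
      forall a u, info_bag inf a = Some u -> u < n].

Definition relay_bounded n (e : relay K Q) :=
  [/\ info_bounded n (cargo e), travelled e <= n & remaining e <= n].

Definition label_bounded n k (L : label K Q) :=
  [/\ info_bounded n (own_info L), root_id L <= n, distance L <= n,
      size (relays L) <= k & {in relays L, forall e, relay_bounded n e}].

Lemma size_code_info : exists C, forall n inf,
  info_bounded n inf -> size (code_info inf) <= C * num_bits n.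
Proof.
pose C := 3 * num_bits #|{: 'I_K * {set 'I_K} * Q}|; exists (9 + C + K * 4 + 1) => n inf.
case=> /size_code_nat id_size /size_code_nat parent_size /size_code_nat depth_size bag_lt.
have fin_size := size_code_fin (info_color inf, info_nbr_colors inf, info_state inf).
have bag_size : size (code_ffun code_option (info_bag inf)) <= K * (3 * num_bits n).+1 + 1.
  rewrite -[X in X * _]card_ord; apply: size_code_ffun => a.
  by apply: size_code_nat; case bag_a: (info_bag inf a) => [u|] //=; apply: bag_lt bag_a.
rewrite /code_info /comp /info_tuple 4!size_code_pair; move: fin_size; rewrite -/C.
have num_bits_gt0 : 0 < num_bits n by [].
have := leq_pmulr C num_bits_gt0; have := leq_pmulr K num_bits_gt0; lia.
Qed.

Lemma size_code_relay : exists C, forall n e,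
  relay_bounded n e -> size (code_relay e) <= C * num_bits n.
Proof.
have [C CP] := size_code_info; exists (C + 6) => n e.
case=> /CP info_size /size_code_nat travelled_size /size_code_nat remaining_size.
by rewrite /code_relay /comp /relay_tuple 2!size_code_pair; lia.
Qed.

Lemma size_code_label k : exists C, forall n L,
  label_bounded n k L -> size (code_label L) <= C * num_bits n.
Proof.
have [C CP] := size_code_info; have [C' C'P] := size_code_relay.
exists (C + 6 + k * C'.+1 + 1) => n L.
case=> /CP info_size /size_code_nat root_size /size_code_nat distance_size size_relays bounded.
have relays_size : size (code_seq code_relay (relays L)) <= k * (C' * num_bits n).+1 + 1.
  apply: leq_trans (size_code_seq (fun e er => C'P n e (bounded e er))) _.
  by rewrite leq_add2r leq_mul2r size_relays orbT.
rewrite /code_label /comp /label_tuple 3!size_code_pair.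
have : k * (C' * num_bits n).+1 <= k * C'.+1 * num_bits n.
  by rewrite -mulnA leq_mul2l mulSn -add1n leq_add2r orbT.
have num_bits_gt0 : 0 < num_bits n by [].
lia.
Qed.

End LabelCode.

(** * The local check *)

Definition info_letter K (Q : finType) (inf : info K Q) : letter K :=
  Letter (info_color inf, info_nbr_colors inf) (fun=> 0 == info_id inf) (fun=> false).

Section LocalCheck.
Variables (K : nat) (M : automaton (letter K)) (k : nat).

(* [nbr j L'] means that the vertex [j] is a neighbor and carries the label [L']. *)
Variables (nbr : nat -> label K (state M) -> Prop) (i : nat) (L : label K (state M)).

Local Notation own := (own_info L).

Definition distance_check := i != 0 -> exists j L', nbr j L' /\ distance L = (distance L').+1.

Definition root_check :=
  (forall j L', nbr j L' -> root_id L' = root_id L) /\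
  (info_depth own = 0 ->
   [/\ root_id L = i, info_parent own = i,
       forall a, a != info_color own -> info_bag own a = None &
       final (step (info_letter own) (info_state own) (init M))]).

Definition bag_check :=
  [/\ info_bag own (info_color own) = Some i,
      forall j L', nbr j L' -> info_depth (own_info L') != info_depth own,
      forall j L', nbr j L' -> info_depth (own_info L') < info_depth own ->
        info_bag own (info_color (own_info L')) = Some j &
      forall a, a \in info_nbr_colors own <-> exists j L', nbr j L' /\ info_bag own a = Some j].

Definition parent_check :=
  0 < info_depth own ->
  (exists L', nbr (info_parent own) L') \/ (exists m, Relay own 0 m \in relays L).

Definition forward_check (e : relay K (state M)) :=
  if remaining e is m.+1 then
    exists j L', nbr j L' /\ Relay (cargo e) (travelled e).+1 m \in relays L'
  else exists L', nbr (info_parent (cargo e)) L'.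

Definition backward_check (e : relay K (state M)) :=
  if travelled e is m.+1 then
    exists j L', nbr j L' /\ Relay (cargo e) m (remaining e).+1 \in relays L'
  else cargo e = own.

Definition relay_check :=
  [/\ size (relays L) <= k,
      {in relays L &, injective (fun e => info_id (cargo e))},
      {in relays L, forall e, info_parent (cargo e) != i},
      {in relays L, forall e, forward_check e} &
      {in relays L, forall e, backward_check e}].

Definition child_info (inf : info K (state M)) :=
  [/\ info_parent inf = i, 0 < info_depth inf &
      exists j L', nbr j L' /\
        (own_info L' = inf \/ exists m, Relay inf m 0 \in relays L')].

Definition children_check := exists s : seq (info K (state M)),
  [/\ forall inf, inf \in s <-> child_info inf,
      uniq (map (@info_id K (state M)) s),
      {in s, forall inf, info_depth inf = (info_depth own).+1 /\
        forall a u, a != info_color inf -> info_bag inf a = Some u -> info_bag own a = Some u} &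
      info_state own = run_forest (@info_letter K (state M)) (@info_state K (state M)) s].

Record local_check : Prop := LocalCheck {
  check_id : info_id own = i;
  check_distance : distance_check;
  check_root : root_check;
  check_bag : bag_check;
  check_parent : parent_check;
  check_relay : relay_check;
  check_children : children_check }.

End LocalCheck.

Definition nbr_label n (G : graph n) T (X : 'I_n.+1 -> T) (v : 'I_n.+1) j L :=
  exists w, [/\ adj G v w, j = val w & L = X w].

(** * Soundness *)

Section Soundness.
Variables (n K k : nat) (G : graph n) (M : automaton (letter K)).
Variable X : 'I_n.+1 -> label K (state M).
Hypothesis X_checked : forall v, local_check k (nbr_label G X v) v (X v).
Local Notation inf v := (own_info (X v)).

Definition decoded_certificate : elim_certificate n K :=
  ElimCertificate (fun v => inord (info_parent (inf v))) (fun v => info_depth (inf v))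
    (inord (root_id (X ord0))) (fun v => info_color (inf v))
    (fun v a => obind insub (info_bag (inf v) a)).
Local Notation D := decoded_certificate.

Lemma checked_connected : connectedG G.
Proof.
suff to0 v : connect (adj G) v ord0.
  by move=> x y; apply: connect_trans (to0 x) _; rewrite (sym_connect_sym (@adj_sym _ G)).
apply: (@descends_connect _ _ _ (fun v => distance (X v))) => w w0.
by have [_ [_ [[u [wu _ ->]] du]]] := check_distance (X_checked w) w0; exists u.
Qed.

Lemma checked_id v : info_id (inf v) = v.
Proof. exact: check_id (X_checked v). Qed.

Lemma checked_info_inj : injective (fun v => inf v).
Proof. by move=> u v /(congr1 (@info_id _ _)); rewrite !checked_id => /val_inj. Qed.

Lemma checked_root_id u v : root_id (X u) = root_id (X v).
Proof.
have /connectP[p] := checked_connected u v.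
elim: p u => [|w p IH] u /= => [_ ->//|/andP[uw /IH{}IH] /IH<-].
by have [same_root _] := check_root (X_checked u); rewrite -(same_root w (X w)) //; exists w.
Qed.

Lemma relay_origin v e : e \in relays (X v) -> exists c, cargo e = inf c.
Proof.
move: {2}(travelled e) (erefl (travelled e)) => m; elim: m v e => [|m IH] v e et ve.
all: have [_ _ _ _ /(_ e ve)] := check_relay (X_checked v); rewrite /backward_check et.
  by exists v.
by case=> _ [_ [[w [_ _ ->]] /IH]]; apply.
Qed.

(* The vertices of the path hold copies of the same information at increasing
   distances, hence they are distinct. *)
Lemma relay_path v e : e \in relays (X v) -> exists s p,
  [/\ path (adj G) v (rcons s p), uniq (v :: rcons s p), val p = info_parent (cargo e),
      forall z, z \in v :: s -> exists2 e', e' \in relays (X z) &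
        cargo e' = cargo e /\ travelled e <= travelled e' &
      exists m, Relay (cargo e) m 0 \in relays (X (last v s))].
Proof.
move: {2}(remaining e) (erefl (remaining e)) => m; elim: m v e => [|m IH] v e er ve.
all: have [_ one_copy /(_ e ve) not_target /(_ e ve) + _] := check_relay (X_checked v).
all: rewrite /forward_check er => -[].
  move=> _ [p [vp pe _]]; exists [::], p; split=> //=; first by rewrite vp.
  - by rewrite inE andbT; apply: contraNneq not_target => ->; rewrite pe.
  - by move=> z; rewrite inE => /eqP->; exists e.
  - by exists (travelled e); rewrite -er; case: (e) ve.
move=> _ [_ [[w [vw _ ->]] we]].
have [s [p [wsp usp pe copies last_copy]]] := IH w (Relay _ _ m) erefl we.
have v_new : v \notin rcons (w :: s) p.
  rewrite mem_rcons inE negb_or; apply/andP; split.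
    by apply: contraNneq not_target => ->; rewrite pe.
  apply/negP => /copies[e' ve' [ee']].
  by rewrite (one_copy _ _ ve' ve) ?ltnn //= ee'.
exists (w :: s), p; split=> //=; [by rewrite vw|exact/andP|].
move=> z; rewrite inE => /orP[/eqP->|/copies[e' ze' [ee' /ltnW lt_travelled]]]; first by exists e.
by exists e'.
Qed.

Lemma checked_parent_message c : 0 < info_depth (inf c) ->
  exists2 p, val p = info_parent (inf c) & child_info (nbr_label G X p) p (inf c).
Proof.
move=> dc; have [[_ [p [cp pc _]]]|[m cm]] := check_parent (X_checked c) dc.
  exists p => //; split=> //; exists (val c), (X c); split; last by left.
  by exists c; rewrite adj_sym.
have [s [p [+ _ pc _ last_copy]]] := relay_path cm.
rewrite rcons_path => /andP[_ sp]; exists p => //; split=> //.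
exists (val (last c s)), (X (last c s)); split; last by right.
by exists (last c s); rewrite adj_sym.
Qed.

Lemma val_decoded_parent c : val (parent D c) = info_parent (inf c).
Proof.
rewrite /= inordK //; have [dc|/checked_parent_message[p <- _]] := posnP (info_depth (inf c)).
  by have [_ /(_ dc)[_ -> _ _]] := check_root (X_checked c); apply: ltn_ord.
exact: ltn_ord.
Qed.

Lemma decoded_parentE c p : val p = info_parent (inf c) -> parent D c = p.
Proof. by move=> pc; apply: val_inj; rewrite val_decoded_parent. Qed.

Lemma child_infoP p x : child_info (nbr_label G X p) p x <->
  exists c, [/\ x = inf c, 0 < depth D c & parent D c = p].
Proof.
split=> [[xp dx [_ [_ [[w [_ _ ->]]]] from]]|[c [-> dc <-]]].
  have [c xc] : exists c, x = inf c by case: from => [<-|[m /relay_origin//]]; exists w.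
  by exists c; subst x; split=> //; apply: decoded_parentE.
by have [p' /decoded_parentE->] := checked_parent_message dc.
Qed.

Lemma decoded_children : exists ch,
  [/\ children (parent D) (depth D) ch,
      forall p, {in ch p, forall c, info_depth (inf c) = (info_depth (inf p)).+1 /\
        forall a u, a != info_color (inf c) ->
          info_bag (inf c) a = Some u -> info_bag (inf p) a = Some u} &
      forall p, info_state (inf p) =
        run_forest (fun c => info_letter (inf c)) (fun c => info_state (inf c)) (ch p)].
Proof.
have /choice[s sP] p := check_children (X_checked p).
pose ch p : seq 'I_n.+1 := [seq inord (info_id x) | x <- s p].
have sE p : s p = [seq inf c | c <- ch p].
  rewrite -map_comp -[LHS]map_id; apply/eq_in_map => x xs.
  have [s_child _ _ _] := sP p; have /child_infoP[c [-> _ _]] := (s_child x).1 xs.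
  by rewrite /= checked_id inord_val.
have mem_ch p c : c \in ch p <-> inf c \in s p.
  by rewrite sE mem_map //; exact: checked_info_inj.
exists ch; split=> [|p c /mem_ch cp|p].
- split=> [p|p c]; first by have [_ + _ _] := sP p; rewrite sE -map_comp => /map_uniq.
  have [inP _ _ _] := sP p; apply/idP/andP => [/mem_ch/inP/child_infoP|[dc /eqP pc]].
    by case=> c' [/checked_info_inj-> dc /eqP].
  by apply/mem_ch/inP/child_infoP; exists c.
- by have [_ _ /(_ _ cp)] := sP p.
- by have [_ _ _ ->] := sP p; rewrite sE /run_forest foldr_map.
Qed.

Lemma decoded_bagE v a u : bag D v a = Some u <-> info_bag (inf v) a = Some (val u).
Proof.
rewrite /=; case: (info_bag _ a) => [j|] //=; split=> [|[->]]; last exact: valK.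
by case: insubP => // w _ <- [->].
Qed.

Lemma decoded_ranked : ranked (parent D) (depth D) (tree_root D).
Proof.
have [ch [chP ch_depth _]] := decoded_children.
have depth_par v : depth D (parent D v) = (depth D v).-1.
  case: (posnP (depth D v)) => [dv|dv].
    have [_ /(_ dv)[_ pv _ _]] := check_root (X_checked v).
    by rewrite (decoded_parentE (esym pv)) dv.
  have [|dvE _] := @ch_depth (parent D v) v; first by rewrite (mem_children chP) dv eqxx.
  by rewrite /= dvE.
have depth_top v : depth D (iter (depth D v) (parent D) v) = 0.
  by rewrite (depth_iter depth_par) subnn.
have depth0_root v : depth D v = 0 -> v = tree_root D.
  move=> dv; have [_ /(_ dv)[rv _ _ _]] := check_root (X_checked v).
  by rewrite /= (checked_root_id _ v) rv inord_val.
split=> // v; apply/eqP/eqP => [|->]; first exact: depth0_root.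
by rewrite -(depth0_root _ (depth_top ord0)) depth_top.
Qed.

Lemma decoded_certifies : certifies D G.
Proof.
have [ch [chP ch_bag _]] := decoded_children.
split=> [|v|a u|u v uv|u v uv duv|v a u dv ne /decoded_bagE bva].
- exact: decoded_ranked.
- by apply/decoded_bagE; have [] := check_bag (X_checked v).
- have dr := depth_root decoded_ranked.
  have [_ /(_ dr)[_ _ none _]] := check_root (X_checked (tree_root D)).
  by case: (eqVneq a (color D (tree_root D))) => // /none + /decoded_bagE => ->.
- have [_ /(_ v (X v)) ne _ _] := check_bag (X_checked u).
  by rewrite eq_sym; apply: ne; exists v.
- have [_ _ /(_ u (X u)) known _] := check_bag (X_checked v).
  by apply/decoded_bagE/known => //; exists u; rewrite adj_sym.
have [|_ bag_up] := @ch_bag (parent D v) v; first by rewrite (mem_children chP) dv eqxx.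
exact/decoded_bagE/bag_up.
Qed.

Lemma decoded_nbr_colors v : nbr_colors D G v = info_nbr_colors (inf v).
Proof.
have [_ _ _ nbrP] := check_bag (X_checked v); apply/setP=> a; rewrite inE.
apply/idP/idP => [|/nbrP[_ [_ [[w [vw -> _]] /decoded_bagE->]]]//].
case bva: (bag D v a) => [w|] // vw; apply/nbrP; exists (val w), (X w).
by split; [exists w|apply/decoded_bagE].
Qed.

Lemma checked_models psi : decides M psi -> models G psi.
Proof.
move=> Mpsi; have [ch [chP _ ch_state]] := decoded_children; have DG := decoded_certifies.
have letterE : certificate_letter G D = fun v => info_letter (inf v).
  apply/funext=> v; rewrite /certificate_letter /certificate_label decoded_nbr_colors.
  by rewrite /info_letter checked_id.
apply/(models_run DG chP (st := fun v => info_state (inf v)) Mpsi) => [p|].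
  by rewrite letterE ch_state.
have [_ /(_ (depth_root decoded_ranked))[_ _ _]] := check_root (X_checked (tree_root D)).
by rewrite letterE.
Qed.

Lemma decoded_routing : exists route, routing D G k route.
Proof.
have /choice[route routeP] c : exists s, c \in remote D G ->
    is_opath G (rcons (c :: s) (parent D c)) /\
    forall z, z \in c :: s -> exists2 e, e \in relays (X z) & info_id (cargo e) = val c.
  case: (boolP (c \in remote D G)) => [|_]; last by exists [::].
  rewrite mem_remote => /andP[dc nc].
  have [[_ [p [cp pc _]]]|[m cm]] := check_parent (X_checked c) dc.
    by rewrite (decoded_parentE (esym pc)) cp in nc.
  have [s [p [csp usp pc copies _]]] := relay_path cm; exists s => _.
  rewrite (decoded_parentE pc); split=> [|z /copies[e ze [ce _]]]; first exact/andP.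
  by exists e => //; rewrite ce checked_id.
exists route; split=> [c /routeP[]//|v]; have [size_relays _ _ _ _] := check_relay (X_checked v).
apply: leq_trans size_relays; rewrite -size_filter -(size_map val).
rewrite -(size_map (fun e => info_id (cargo e)) (relays (X v))); apply: uniq_leq_size.
  by rewrite (map_inj_uniq val_inj) filter_uniq ?uniq_remote.
move=> _ /mapP[c + ->]; rewrite mem_filter => /andP[vc /routeP[_ /(_ v vc)[e ve <-]]].
exact: map_f.
Qed.

End Soundness.

(** * Completeness *)

Section Completeness.
Variables (n K k : nat) (G : graph n) (M : automaton (letter K)) (D : elim_certificate n K).
Variables (dist : 'I_n.+1 -> nat) (route : 'I_n.+1 -> seq 'I_n.+1).
Hypothesis DG : certifies D G.
Hypothesis DR : routing D G k route.
Hypothesis dist_descends : descends (adj G) ord0 dist.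
Hypothesis dist_lt : forall v, dist v < n.+1.

Let rk : ranked (parent D) (depth D) (tree_root D) := certifies_ranked DG.
Local Notation ch := (children_of (parent D) (depth D)).
Local Notation chP := (children_ofP (parent D) (depth D)).

Definition honest_info (v : 'I_n.+1) : info K (state M) :=
  Info v (parent D v) (depth D v) (color D v) (nbr_colors D G v)
    (run M (btree_map (certificate_letter G D) (subforest (depth D) ch v)))
    [ffun a => omap val (bag D v a)].

Definition honest_relay c i := Relay (honest_info c) i (size (route c) - i).

Definition honest_label (v : 'I_n.+1) : label K (state M) :=
  Label (honest_info v) (tree_root D) (dist v)
    [seq honest_relay c (index v (c :: route c)) | c <- remote D G & v \in c :: route c].

Local Notation honest_nbr := (nbr_label G honest_label).

Lemma honest_stateE p : info_state (honest_info p) =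
  run_forest (certificate_letter G D) (fun c => info_state (honest_info c)) (ch p).
Proof. exact: (run_subforest rk chP _ _).2. Qed.

Lemma uniq_route c : c \in remote D G -> uniq (rcons (c :: route c) (parent D c)).
Proof. by case: DR => opaths _ /opaths/andP[]. Qed.

Lemma size_route c : c \in remote D G -> size (route c) < n.
Proof.
move=> /uniq_route/card_uniqP; rewrite size_rcons /= => card_route.
by have := max_card (mem (rcons (c :: route c) (parent D c))); rewrite card_route card_ord.
Qed.

Lemma adj_route c i : c \in remote D G -> i <= size (route c) ->
  adj G (nth c (c :: route c) i) (nth (parent D c) (route c) i).
Proof.
case: DR => opaths _ /opaths/andP[/(pathP c) c_path _] ic.
have := c_path i; rewrite size_rcons ltnS -rcons_cons !nth_rcons ltnS ic => /(_ isT).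
case: ltngtP ic => // [ic|->] _; last by rewrite [nth (parent D c) _ _]nth_default.
by rewrite (set_nth_default c (parent D c)).
Qed.

Lemma mem_honest_relays c i : c \in remote D G -> i <= size (route c) ->
  honest_relay c i \in relays (honest_label (nth c (c :: route c) i)).
Proof.
move=> cr ic; apply/mapP; exists c; first by rewrite mem_filter cr andbT mem_nth.
rewrite index_uniq //; have := uniq_route cr.
by rewrite rcons_uniq => /andP[].
Qed.

Lemma honest_relayP v e : e \in relays (honest_label v) -> exists c i,
  [/\ c \in remote D G, i <= size (route c), v = nth c (c :: route c) i & e = honest_relay c i].
Proof.
case/mapP=> c; rewrite mem_filter => /andP[vc cr] ->; exists c, (index v (c :: route c)).
by rewrite nth_index // -ltnS -[X in _ < X]/(size (c :: route c)) index_mem.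
Qed.

Lemma honest_relay_origin v e : e \in relays (honest_label v) -> exists c, cargo e = honest_info c.
Proof. by case/honest_relayP=> c [i [_ _ _ ->]]; exists c. Qed.

Lemma honest_label_bounded v : label_bounded n.+1 k (honest_label v).
Proof.
have info_ok c : info_bounded n.+1 (honest_info c).
  split=> [||| a u]; try exact/ltnW/ltn_ord.
    by have := depth_lt_card rk c; rewrite card_ord => /ltnW.
  by rewrite ffunE; case: (bag D c a) => //= w [<-]; apply: ltn_ord.
split=> [||||e /honest_relayP[c [i [cr ic _ ->]]]] /=.
- exact: info_ok.
- exact/ltnW/ltn_ord.
- exact/ltnW/dist_lt.
- by rewrite size_map size_filter; case: DR.
- by split=> //=; have := size_route cr; lia.
Qed.

Lemma honest_distance_check v : distance_check (honest_nbr v) v (honest_label v).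
Proof.
by move=> /dist_descends[w vw vE]; exists (val w), (honest_label w); split=> //; exists w.
Qed.

Lemma honest_root_check v :
  final (step (certificate_letter G D (tree_root D))
    (info_state (honest_info (tree_root D))) (init M)) ->
  root_check (honest_nbr v) v (honest_label v).
Proof.
move=> accepting; split=> [j _ [w [_ _ ->]] //|/eqP].
rewrite (depth_eq0 rk) => /eqP->; split=> //=; first by rewrite (parent_root rk).
move=> a; apply: contraNeq; rewrite ffunE; case bra: (bag D _ a) => [u|] // _.
by rewrite (bag_root DG bra).
Qed.

Lemma honest_bag_check v : bag_check (honest_nbr v) v (honest_label v).
Proof.
split=> [|j _ [w [vw _ ->]]|_ _ [w [vw -> ->]] /= dwv|a] /=.
- by rewrite ffunE (bag_color DG).
- by rewrite eq_sym (depth_adj DG vw).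
- by rewrite ffunE (bag_adj DG) // adj_sym.
rewrite inE ffunE; case: (bag D v a) => [u|] /=; last by split=> // -[? [? []]].
split=> [vu|[j [L [[w [vw -> _]] [/val_inj->//]]]]].
by exists (val u), (honest_label u); split=> //; exists u.
Qed.

Lemma honest_parent_check v : parent_check (honest_nbr v) (honest_label v).
Proof.
move=> dv; case: (boolP (adj G v (parent D v))) => [vp|nv].
  by left; exists (honest_label (parent D v)), (parent D v).
right; exists (size (route v)).
have := @mem_honest_relays v 0; rewrite /honest_relay subn0; apply=> //.
by rewrite mem_remote dv nv.
Qed.

Lemma honest_forward_check v e :
  e \in relays (honest_label v) -> forward_check (honest_nbr v) e.
Proof.
case/honest_relayP=> c [i [cr ic -> ->]]; have := adj_route cr ic; rewrite /forward_check /=.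
case remE: (size (route c) - i) => [|m] => [|ci].
  rewrite [nth (parent D c) _ _]nth_default -?subn_eq0 ?remE // => ci.
  by exists (honest_label (parent D c)), (parent D c).
have lt_i : i < size (route c) by lia.
rewrite (set_nth_default c (parent D c)) // in ci.
exists (nth c (c :: route c) i.+1), (honest_label (nth c (c :: route c) i.+1)); split.
  by exists (nth c (c :: route c) i.+1).
have -> : m = size (route c) - i.+1 by lia.
exact: mem_honest_relays cr lt_i.
Qed.

Lemma honest_backward_check v e :
  e \in relays (honest_label v) -> backward_check (honest_nbr v) (honest_label v) e.
Proof.
case/honest_relayP=> c [[|i] [cr ic -> ->]] //; rewrite /backward_check /=.
have := adj_route cr (ltnW ic); rewrite (set_nth_default c) // adj_sym => adj_i.
exists (val (nth c (c :: route c) i)), (honest_label (nth c (c :: route c) i)); split.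
  by exists (nth c (c :: route c) i).
by rewrite subnSK //; exact: mem_honest_relays cr (ltnW ic).
Qed.

Lemma honest_relay_check v : relay_check k (honest_nbr v) v (honest_label v).
Proof.
split=> [|e e' /mapP[c _ ->] /mapP[c' _ ->] /val_inj->//|e|e|e].
- by rewrite size_map size_filter; case: DR.
- case/honest_relayP=> c [i [cr ic -> ->]] /=; have := uniq_route cr.
  rewrite rcons_uniq => /andP[+ _]; apply: contraNneq => /val_inj->.
  by rewrite mem_nth.
- exact: honest_forward_check.
- exact: honest_backward_check.
Qed.

Lemma honest_child_info v inf :
  child_info (honest_nbr v) v inf <-> exists2 c, c \in ch v & inf = honest_info c.
Proof.
split=> [[inf_v dinf [_ [_ [[w [_ _ ->]] from]]]]|[c]].
  have [c infE] : exists c, inf = honest_info c.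
    by case: from => [<-|[m /honest_relay_origin]]; [exists w|].
  subst inf; exists c => //; rewrite (mem_children chP) dinf.
  exact/eqP/val_inj.
rewrite (mem_children chP) => /andP[dc /eqP<-] ->; split=> //.
case: (boolP (adj G c (parent D c))) => [cp|nc].
  exists (val c), (honest_label c); split; last by left.
  by exists c; rewrite adj_sym.
have cr : c \in remote D G by rewrite mem_remote dc.
pose z := nth c (c :: route c) (size (route c)); exists (val z), (honest_label z).
have := adj_route cr (leqnn _); rewrite [nth (parent D c) _ _]nth_default // => zc; split.
  by exists z; rewrite adj_sym.
right; exists (size (route c)).
by have := mem_honest_relays cr (leqnn _); rewrite /honest_relay subnn.
Qed.

Lemma honest_children_check v : children_check (honest_nbr v) v (honest_label v).
Proof.
exists (map honest_info (ch v)); split.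
- by move=> inf; rewrite honest_child_info; split=> /mapP.
- rewrite -map_comp (map_inj_uniq (f := @info_id _ _ \o honest_info)); last exact: val_inj.
  exact: (uniq_children chP v).
- move=> _ /mapP[c cv ->]; split=> [|a u ne]; first exact: (depth_child rk chP cv).
  rewrite !ffunE; case bca: (bag D c a) => [w|] //= [<-].
  move: cv; rewrite (mem_children chP) => /andP[dc /eqP<-].
  by rewrite (bag_parent DG dc ne bca).
by rewrite /run_forest foldr_map; apply: honest_stateE.
Qed.

Lemma honest_local_check v psi :
  decides M psi -> models G psi -> local_check k (honest_nbr v) v (honest_label v).
Proof.
move=> Mpsi Gpsi; split=> //.
- exact: honest_distance_check.
- exact/honest_root_check/(models_run DG chP Mpsi honest_stateE).1.
- exact: honest_bag_check.
- exact: honest_parent_check.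
- exact: honest_relay_check.
- exact: honest_children_check.
Qed.

End Completeness.

Section Labelling.
Variables (n k : nat) (G : graph n) (M : automaton (letter k.+1)) (psi : mso).
Hypothesis Mpsi : decides M psi.

Theorem local_check_complete : connectedG G -> lvtw_le G k%:Z -> models G psi ->
  exists X : 'I_n.+1 -> label k.+1 (state M), forall v,
    local_check k (nbr_label G X v) v (X v) /\ label_bounded n.+1 k (X v).
Proof.
move=> cG /(lvtw_certificateP _ cG)[D [route [DG DR]]] Gpsi.
have [|dist [dist_descends _ dist_lt]] := @descends_exists _ (adj G) ord0; first by move=> v.
rewrite card_ord in dist_lt; exists (honest_label G M D dist route) => v; split.
  exact: (honest_local_check DG DR dist_descends v Mpsi Gpsi).
exact: honest_label_bounded.
Qed.

Theorem local_check_sound (X : 'I_n.+1 -> label k.+1 (state M)) :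
  (forall v, local_check k (nbr_label G X v) v (X v)) ->
  [/\ connectedG G, lvtw_le G k%:Z & models G psi].
Proof.
move=> X_checked; have cG := checked_connected X_checked.
split=> //; last exact: (checked_models X_checked Mpsi).
apply/(lvtw_certificateP _ cG); have [route DR] := decoded_routing X_checked.
exists (decoded_certificate X), route; split=> //.
exact: (decoded_certifies X_checked).
Qed.

End Labelling.

(** * Proof labeling schemes from local checks *)

Lemma has_log_PLS_empty (cls : forall n, graph n -> Prop) :
  (forall n (G : graph n), ~ cls n G) -> has_log_PLS cls.
Proof.
move=> cls0; exists (fun _ _ _ => [::]), (fun _ _ => false); split.
- by move=> n G /cls0.
- by move=> n G _ lab; exists ord0.
- by exists 0 => n G /cls0.
Qed.

Lemma mem_view n (G : graph n) lab v j b : (j, b) \in view G lab v <->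
  exists w, [/\ (w == v) || adj G v w, j = (val w).+1 & b = lab w].
Proof.
split; first by case/mapP=> w; rewrite mem_filter => /andP[vw _] [-> ->]; exists w.
by case=> w [vw -> ->]; apply/mapP; exists w => //; rewrite mem_filter vw mem_enum.
Qed.

(* A view lists the identifiers starting from 1. *)
Definition view_nbr T (code : T -> bitseq) i (vw : seq (nat * bitseq)) j (L : T) :=
  j != i /\ (j.+1, code L) \in vw.

Lemma view_nbrE n (G : graph n) T (code : T -> bitseq) (X : 'I_n.+1 -> T) (v : 'I_n.+1) :
  injective code -> view_nbr code v (view G (code \o X) v) = nbr_label G X v.
Proof.
move=> code_inj; apply/funext=> j; apply/funext=> L; apply/propext; split.
  case=> jv /mem_view[w [vw [jw] /code_inj LX]]; exists w; split=> //.
  by case/orP: vw => // /eqP wv; rewrite jw wv eqxx in jv.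
case=> w [vw -> ->]; split; first by apply: contraTneq vw => /val_inj->; rewrite adj_irr.
by apply/mem_view; exists w; rewrite vw orbT.
Qed.

Theorem has_log_PLS_of_check T (code : T -> bitseq) (check : (nat -> T -> Prop) -> nat -> T -> Prop)
    C (cls : forall n, graph n -> Prop) :
  injective code ->
  (forall n (G : graph n), cls n G -> exists X : 'I_n.+1 -> T, forall v,
     check (nbr_label G X v) v (X v) /\ size (code (X v)) <= C * num_bits n.+1) ->
  (forall n (G : graph n) (X : 'I_n.+1 -> T),
     (forall v, check (nbr_label G X v) v (X v)) -> cls n G) ->
  has_log_PLS cls.
Proof.
move=> code_inj complete sound.
pose prover n (G : graph n) v : bitseq :=
  if pselect (cls n G) is left clsG then code (sval (cid (complete n G clsG)) v) else [::].
pose verifier i vw :=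
  `[< exists L, (i, code L) \in vw /\ check (view_nbr code i.-1 vw) i.-1 L >].
have proverE n (G : graph n) : cls n G -> exists X : 'I_n.+1 -> T, prover n G = code \o X /\
    forall v, check (nbr_label G X v) v (X v) /\ size (code (X v)) <= C * num_bits n.+1.
  rewrite /prover; case: pselect => // clsG _; case: (cid _) => X XP.
  by exists X.
exists prover, verifier; split=> [n G /proverE[X [-> XP]] v|n G nclsG lab|].
- apply/asboolP; exists (X v); rewrite (view_nbrE _ _ _ code_inj).
  by split; [apply/mem_view; exists v; rewrite eqxx|have [] := XP v].
- apply: contra_notP nclsG => /forallNP all_accept.
  have /choice[X XP] v : exists L,
      lab v = code L /\ check (view_nbr code v (view G lab v)) v L.
    have /negP := all_accept v; rewrite negbK => /asboolP[L [/mem_view[w vwL] checkL]].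
    by exists L; split=> //; case: vwL => _ [/val_inj->] ->.
  have labE : lab = code \o X by apply/funext=> v; have [] := XP v.
  by apply: (sound n G X) => v; have [_] := XP v; rewrite labE (view_nbrE _ _ _ code_inj).
by exists C => n G /proverE[X [-> XP]] v; have [] := XP v.
Qed.

Theorem theorem9 (omega : int) (psi : mso) :
  mso_sentence psi ->
  has_log_PLS (fun n (G : graph n) =>
    [/\ connectedG G, lvtw_le G omega & models G psi]).
Proof.
move=> _; case: omega => [k|m]; last first.
  by apply: has_log_PLS_empty => n G [_ /lvtw_le_ge0].
have [M Mpsi] := mso_automaton_exists k.+1 psi.
have [C size_code] := size_code_label k.+1 (state M) k.
apply: (has_log_PLS_of_check (C := C) (@code_label_inj k.+1 (state M)) (check := local_check k)).
  move=> n G [cG tG Gpsi]; have [X XP] := local_check_complete Mpsi cG tG Gpsi.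
  by exists X => v; have [checkX /size_code] := XP v.
by move=> n G X /(local_check_sound Mpsi).
Qed.
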